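(* Let $0<p<1$ and let $\rho_{\mathrm{Bell}}=p\,|v_1\rangle\langle v_1|+(1-p)\,|v_2\rangle\langle v_2|$ be the two-qubit state with $|v_1\rangle=(|01\rangle+|10\rangle)/\sqrt2$ and $|v_2\rangle=(|01\rangle-|10\rangle)/\sqrt2$, one qubit held by Alice ($A$) and the other by Bob ($B$). Let $\varepsilon\in(0,1)$ and $\Omega\in\{\text{1-LOCC},\text{LOCC},\text{SEP},\text{PPT}\}$. Then, for the number $n$ of copies, $$E_{\mathrm{D},\Omega}^{(1),\varepsilon}(\rho_{\mathrm{Bell}}^{\otimes n})=n(1-h_2(p))+\sqrt{n\,p(1-p)\Big(\log\frac{1-p}{p}\Big)^2}\;\Phi^{-1}(\varepsilon)+O(\log n),$$ where $h_2(p)=-p\log p-(1-p)\log(1-p)$ is the binary entropy.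
   Context: All Hilbert spaces are finite-dimensional; $\log$ is base $2$. The $O(\log n)$ term is as $n\to\infty$ with $p$ and $\varepsilon$ fixed. $\Phi^{-1}$ is the inverse of the cumulative distribution function of the standard normal distribution. Operation classes (completely positive trace-preserving maps $\Pi_{AB\to A'B'}$, Alice holding $A,A'$, Bob holding $B,B'$): LOCC operations are those realizable by local operations and classical communication; 1-LOCC those using only one-way classical communication from Alice to Bob. With Choi–Jamiołkowski matrix $J_\Pi=\sum_{i,j,m,k}|i_Aj_B\rangle\langle m_Ak_B|\otimes\Pi(|i_Aj_B\rangle\langle m_Ak_B|)$, $\Pi$ is SEP if $J_\Pi$ is separable across $AA':BB'$ (a convex combination of tensor products of positive semidefinite operators), and PPT if $J_\Pi^{T_{BB'}}\ge0$, where $T_{BB'}$ is partial transpose on $BB'$. Distillable entanglement: for $k\in\mathbb N$, $k\ge1$, let $\Psi_k=\frac1k\sum_{i,j=0}^{k-1}|ii\rangle\langle jj|$ on $A'\otimes B'$ with $\dim A'=\dim B'=k$; $F_\Omega(\rho_{AB},k)=\max_{\Pi\in\Omega}\operatorname{Tr}\Pi_{AB\to A'B'}(\rho_{AB})\Psi_k$ (supremum if not attained); and $$E_{\mathrm{D},\Omega}^{(1),\varepsilon}(\rho_{AB})=\log\max\{k\in\mathbb N:F_\Omega(\rho_{AB},k)\ge1-\varepsilon\}.$$ For an $n$-fold tensor power the bipartition is $A^n:B^n$. *)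

(* Defs.v *)
From HB Require Import structures.
From mathcomp Require Import all_boot all_order all_algebra.
From mathcomp Require Import all_classical all_reals all_analysis.
From mathcomp Require Import complex mxtens.

Set Implicit Arguments.
Unset Strict Implicit.
Unset Printing Implicit Defensive.

Import Order.TTheory GRing.Theory Num.Theory.
Import numFieldNormedType.Exports.

Local Open Scope classical_set_scope.
Local Open Scope complex_scope.
Local Open Scope ring_scope.

(* A d-dimensional Hilbert space is C^d with C = R[i], and operators on it are
   matrices.  The composite of systems of dimensions a and b has dimension
   a * b, its basis being indexed through mxtens_index; accordingly operators
   compose by the Kronecker product *t. *)

Section Matrices.
Variable R : realType.
Local Notation C := R[i].

Definition adjmx m n (A : 'M[C]_(m, n)) : 'M[C]_(n, m) :=
  map_mx Num.conj A^T.

(* In the order of C, 0 <= z means that z is real and nonnegative. *)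
Definition psdmx n (A : 'M[C]_n) : Prop :=
  forall v : 'cV[C]_n, 0 <= (adjmx v *m A *m v) 0 0.

Definition ket d (i : 'I_d) : 'cV[C]_d := delta_mx i 0.

Definition proj_of d (v : 'cV[C]_d) : 'M[C]_d := v *m adjmx v.

(* Relabelling of bases (A A') (B B') -> (A B) (A' B'). *)
Definition swap_index a b a' b' (s : 'I_((a * a') * (b * b'))) :
    'I_((a * b) * (a' * b')) :=
  let u := mxtens_unindex (mxtens_unindex s).1 in
  let v := mxtens_unindex (mxtens_unindex s).2 in
  mxtens_index (mxtens_index (u.1, v.1), mxtens_index (u.2, v.2)).

Definition regroup a b a' b' (X : 'M[C]_((a * b) * (a' * b'))) :
    'M[C]_((a * a') * (b * b')) :=
  mxsub (@swap_index a b a' b') (@swap_index a b a' b') X.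

(* n-fold tensor power of a bipartite operator on A : B, regrouped as an
   operator on A^n : B^n.  As for ntensmx, the successor case is split so that
   a ^ n.+2 is convertible to a * a ^ n.+1. *)
Fixpoint bipower_rec a b (X : 'M[C]_(a * b)) n :
    'M[C]_(a ^ n.+1 * b ^ n.+1) :=
  if n is n'.+1 then regroup (X *t bipower_rec X n') else X.

Definition bipower a b (X : 'M[C]_(a * b)) n : 'M[C]_(a ^ n * b ^ n) :=
  if n is n'.+1 return 'M[C]_(a ^ n * b ^ n) then bipower_rec X n' else 1%:M.

Definition partial_transpose a b (X : 'M[C]_(a * b)) : 'M[C]_(a * b) :=
  \matrix_(s, t)
    X (mxtens_index ((mxtens_unindex s).1, (mxtens_unindex t).2))
      (mxtens_index ((mxtens_unindex t).1, (mxtens_unindex s).2)).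

Definition separable a b (X : 'M[C]_(a * b)) : Prop :=
  exists (r : nat) (w : 'I_r -> R) (P : 'I_r -> 'M[C]_a) (Q : 'I_r -> 'M[C]_b),
    [/\ forall x, 0 <= w x,
        \sum_x w x = 1,
        forall x, psdmx (P x) /\ psdmx (Q x)
      & X = \sum_x (w x)%:C *: (P x *t Q x)].

End Matrices.

Section Operations.
Variable R : realType.
Local Notation C := R[i].

(* Tensor product of two linear maps on operators, determined by its values
   on the products of matrix units. *)
Definition tensmap a b a' b' (E : 'M[C]_a -> 'M[C]_a') (F : 'M[C]_b -> 'M[C]_b')
    (X : 'M[C]_(a * b)) : 'M[C]_(a' * b') :=
  \sum_s \sum_t X s t *:
    (E (delta_mx (mxtens_unindex s).1 (mxtens_unindex t).1) *t
     F (delta_mx (mxtens_unindex s).2 (mxtens_unindex t).2)).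

Definition cp a b (E : 'M[C]_a -> 'M[C]_b) : Prop :=
  linear E /\
  forall (k : nat) (X : 'M[C]_(k * a)),
    psdmx X -> psdmx (tensmap (@idfun 'M[C]_k) E X).

Definition cptp a b (E : 'M[C]_a -> 'M[C]_b) : Prop :=
  cp E /\ forall X, \tr (E X) = \tr X.

(* The dimension of the output system may depend on the outcome x. *)
Definition instrument a r (d : 'I_r -> nat)
    (E : forall x : 'I_r, 'M[C]_a -> 'M[C]_(d x)) : Prop :=
  (forall x, cp (E x)) /\ forall X, \sum_x \tr (E x X) = \tr X.

Definition one_way_locc a b a' b' (Pi : 'M[C]_(a * b) -> 'M[C]_(a' * b')) :
    Prop :=
  exists (r : nat) (E : 'I_r -> 'M[C]_a -> 'M[C]_a')
      (F : 'I_r -> 'M[C]_b -> 'M[C]_b'),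
    [/\ instrument E, forall x, cptp (F x)
      & forall X, Pi X = \sum_x tensmap (E x) (F x) X].

(* Protocols with an arbitrary finite number of rounds: in each round one party
   applies an instrument and broadcasts the outcome x, and the rest of the
   protocol may depend on x; it ends with a local channel on each side. *)
Inductive locc a' b' :
    forall a b, ('M[C]_(a * b) -> 'M[C]_(a' * b')) -> Prop :=
| locc_local a b (E : 'M[C]_a -> 'M[C]_a') (F : 'M[C]_b -> 'M[C]_b')
    (Pi : 'M[C]_(a * b) -> 'M[C]_(a' * b')) :
    cptp E -> cptp F ->
    (forall X, Pi X = tensmap E F X) ->
    locc Pi
| locc_alice a b r (d : 'I_r -> nat)
    (E : forall x : 'I_r, 'M[C]_a -> 'M[C]_(d x))
    (L : forall x : 'I_r, 'M[C]_(d x * b) -> 'M[C]_(a' * b'))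
    (Pi : 'M[C]_(a * b) -> 'M[C]_(a' * b')) :
    instrument E -> (forall x, locc (L x)) ->
    (forall X, Pi X = \sum_x L x (tensmap (E x) (@idfun 'M[C]_b) X)) ->
    locc Pi
| locc_bob a b r (d : 'I_r -> nat)
    (F : forall x : 'I_r, 'M[C]_b -> 'M[C]_(d x))
    (L : forall x : 'I_r, 'M[C]_(a * d x) -> 'M[C]_(a' * b'))
    (Pi : 'M[C]_(a * b) -> 'M[C]_(a' * b')) :
    instrument F -> (forall x, locc (L x)) ->
    (forall X, Pi X = \sum_x L x (tensmap (@idfun 'M[C]_a) (F x) X)) ->
    locc Pi.

Definition choi m n (E : 'M[C]_m -> 'M[C]_n) : 'M[C]_(m * n) :=
  \sum_(s < m) \sum_(t < m) delta_mx s t *t E (delta_mx s t).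

End Operations.

Inductive operation_class := OneLOCC | LOCC | SEP | PPT.

Section Distillation.
Variable R : realType.
Local Notation C := R[i].

Definition in_class (Omega : operation_class) a b a' b'
    (Pi : 'M[C]_(a * b) -> 'M[C]_(a' * b')) : Prop :=
  cptp Pi /\
  match Omega with
  | OneLOCC => one_way_locc Pi
  | LOCC => locc Pi
  | SEP => separable (regroup (choi Pi))
  | PPT => psdmx (partial_transpose (regroup (choi Pi)))
  end.

Definition max_entangled k : 'M[C]_(k * k) :=
  (k%:R)^-1 *: \sum_(i < k) \sum_(j < k)
    delta_mx (mxtens_index (i, i)) (mxtens_index (j, j)).

(* The trace below is real for a state rho; Re only changes its type. *)
Definition distillation_fidelity (Omega : operation_class) a b
    (rho : 'M[C]_(a * b)) (k : nat) : R :=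
  sup [set f : R | exists Pi : 'M[C]_(a * b) -> 'M[C]_(k * k),
         in_class Omega Pi /\ f = complex.Re (\tr (Pi rho *m max_entangled k))].

Definition log2 (x : R) : R := ln x / ln 2.

Definition max_nat (S : set nat) : nat :=
  xget 0%N [set k | S k /\ forall j, S j -> (j <= k)%N].

Definition distillable_entanglement (Omega : operation_class) (eps : R) a b
    (rho : 'M[C]_(a * b)) : R :=
  log2 (max_nat [set k | (1 <= k)%N /\
                         1 - eps <= distillation_fidelity Omega rho k])%:R.

Definition bell_v1 : 'cV[C]_(2 * 2) :=
  (Num.sqrt 2)^-1%:C *: (ket R 0 *t ket R 1 + ket R 1 *t ket R 0).

Definition bell_v2 : 'cV[C]_(2 * 2) :=
  (Num.sqrt 2)^-1%:C *: (ket R 0 *t ket R 1 - ket R 1 *t ket R 0).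

Definition rho_bell (p : R) : 'M[C]_(2 * 2) :=
  p%:C *: proj_of bell_v1 + (1 - p)%:C *: proj_of bell_v2.

Definition binary_entropy (p : R) : R :=
  - p * log2 p - (1 - p) * log2 (1 - p).

Definition normal_cdf (x : R) : R := fine (normal_prob 0 1 `]-oo, x]).

Definition normal_cdf_inv (e : R) : R := xget 0 [set x | normal_cdf x = e].

End Distillation.

(* Main.v *)
(** The n-fold tensor power is the mixture, over x in {0,1}^n with Bernoulli
    weights P(x), of maximally entangled vectors psi_x that differ only by the
    phase error x.

    Converse.  Let m_x be the overlap with Psi_k of the image of psi_x under an
    operation, so 0 <= m_x <= 1.  The sum of the projectors on the psi_x is a sum
    of 2^n product basis states; in all four classes these have images with
    positive partial transpose, whose overlap with Psi_k is at most 1/k.  Hence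
    the m_x add up to at most 2^n/k, and the fidelity, the sum of the P(x) m_x,
    is at most Pr[P(X) > t] + t 2^n/k for every t.

    Achievability.  Given codewords c_1, ..., c_k in {0,1}^n, Alice measures with
    the Kraus operators A_t = k^(-1/2) sum_j |j><chi_(c_j + t)| in the conjugate
    basis and sends t; Bob decodes coherently.  The fidelity is the sum of the
    P(x) (g_x/k)^2, where g_x counts the codewords that survive the error x.  A
    greedy code, decoded to the errors T = {P >= t}, reaches
    P(T) - 2 (k - 1) |T|/2^n, with |T| <= 1/t.

    Taking k = t 2^n n^(-1/2) up to a constant, both bounds reduce the claim to
    locating a quantile of a binomial distribution to within O(1) when
    probabilities are perturbed by O(n^(-1/2)).  This is a Berry-Esseen bound,
    obtained by Stein's method. *)
From HB Require Import structures.
Require Import Defs.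
From mathcomp Require Import all_boot all_order all_algebra.
From mathcomp Require Import all_classical all_reals all_analysis.
From mathcomp Require Import complex mxtens.
From mathcomp Require Import ring lra zify spectral.
Import Order.TTheory GRing.Theory Num.Theory.
Import numFieldNormedType.Exports.
Local Open Scope classical_set_scope.
Local Open Scope ring_scope.

Set Implicit Arguments.
Unset Strict Implicit.
Unset Printing Implicit Defensive.

(** * The standard normal distribution function *)

Lemma mvt_closed (R : realType) (f df : R -> R) (a b : R) : a <= b ->
  (forall x : R, a <= x <= b -> is_derive x 1 f (df x)) ->
  exists2 c, a <= c <= b & f b - f a = df c * (b - a).
Proof.
move=> ab fD.
have [|x|c cab ->] := @MVT_segment R f df a b ab; last by exists c.
- by move=> x /[!in_itv]/= /andP[ax xb]; apply: fD; rewrite !ltW.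
apply: derivable_within_continuous => {}x /[!in_itv]/= xab.
by have [] := fD x xab.
Qed.

Section StandardNormal.
Variable R : realType.
Local Notation Phi := (@normal_cdf R).
Local Notation phi := (@normal_pdf R 0 1).

Lemma normal_pdf01E (x : R) :
  phi x = normal_peak 1 * expR (- x ^+ 2 / 2).
Proof. by rewrite normal_pdfE ?oner_neq0// /normal_fun subr0 expr1n. Qed.

Lemma normal_pdf01_gt0 (x : R) : 0 < phi x.
Proof.
by rewrite normal_pdf01E mulr_gt0 ?expR_gt0 ?normal_peak_gt0 ?oner_neq0.
Qed.

Lemma is_derive_normal_pdf01 (x : R) : is_derive x 1 phi (- x * phi x).
Proof.
have -> : phi = (fun y => normal_peak 1 * expR (- y ^+ 2 / 2)).
  by apply/funext => y; exact: normal_pdf01E.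
by apply: is_derive_eq; rewrite /GRing.scale/=; field.
Qed.

Lemma is_derive_normal_cdf (x : R) : is_derive x 1 Phi (phi x).
Proof.
have iphi : (@lebesgue_measure R).-integrable [set` Interval -oo%O (BRight (x + 1))]
    (EFin \o phi).
  exact: integrableS (integrable_normal_pdf 0 1).
have xx : x < x + 1 by rewrite ltrDl.
have cphi : {for x, continuous phi}.
  by apply: continuous_normal_pdf; exact: oner_neq0.
have [dF] := continuous_FTC1 xx iphi (ltNyr _) cphi.
rewrite derive1E => <-.
exact: derivableP dF.
Qed.

Lemma normal_cdf_cvgNy : Phi @ -oo --> (0 : R).
Proof.
pose idTR : measurableTypeR R -> R := idfun.
pose m := @isMeasurableFun.Build _ _ _ _ idTR (@measurable_id _ _ setT).
pose X : {RV (normal_prob 0 1 : probability _ R) >-> R} :=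
  HB.pack idTR m.
have -> : Phi = fine \o cdf X by [].
exact/fine_cvg/cvg_cdfNy0.
Qed.

Lemma normal_cdf_cvgy : Phi @ +oo --> (1 : R).
Proof.
pose idTR : measurableTypeR R -> R := idfun.
pose m := @isMeasurableFun.Build _ _ _ _ idTR (@measurable_id _ _ setT).
pose X : {RV (normal_prob 0 1 : probability _ R) >-> R} :=
  HB.pack idTR m.
have -> : Phi = fine \o cdf X by [].
exact/fine_cvg/cvg_cdfy1.
Qed.

End StandardNormal.

(** * Mills ratio inequalities for the two tails *)

Section MillsRatio.
Variable R : realType.
Local Notation Phi := (@normal_cdf R).
Local Notation phi := (@normal_pdf R 0 1).

Lemma ge0_derive_homo (f df : R -> R) (a b : R) : a <= b ->
  (forall x : R, a <= x <= b -> is_derive x 1 f (df x)) ->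
  (forall x, a <= x <= b -> 0 <= df x) -> f a <= f b.
Proof.
move=> ab fD df0; have [c cab E] := mvt_closed ab fD.
by rewrite -subr_ge0 E mulr_ge0 ?df0 ?subr_ge0.
Qed.

Lemma normal_cdf_homo (x y : R) : x <= y -> Phi x <= Phi y.
Proof.
move=> xy; apply: (ge0_derive_homo xy) => z _; first exact: is_derive_normal_cdf.
exact/ltW/normal_pdf01_gt0.
Qed.

Lemma normal_cdf_ge0 (x : R) : 0 <= Phi x.
Proof. by rewrite fine_ge0// measure_ge0. Qed.

Lemma normal_cdf_le1 (x : R) : Phi x <= 1.
Proof.
rewrite -[leRHS]/(fine 1%E) fine_le//; last exact: probability_le1.
exact: fin_num_measure.
Qed.

Lemma normal_pdf01N (x : R) : phi (- x) = phi x.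
Proof. by rewrite !normal_pdf01E sqrrN. Qed.

Lemma normal_pdf01_homo (x y : R) : x ^+ 2 <= y ^+ 2 -> phi y <= phi x.
Proof.
move=> xy; rewrite !normal_pdf01E ler_wpM2l ?normal_peak_ge0// ler_expR; lra.
Qed.

(** On the negative axis [N v] = - phi(v)/v - F(v) has derivative phi(v)/v^2, so it increases; since
    [N v] is at least - F(v), which tends to 0 at minus infinity, [N w] is nonnegative. A general F
    serves both [Phi] and its reflected tail. *)
Lemma mills_ratio (F : R -> R) :
  (forall x : R, is_derive x 1 F (phi x)) -> (F @ -oo --> (0 : R)) ->
  forall w : R, w < 0 -> - w * F w <= phi w.
Proof.
move=> FD F0 w w0.
pose N v := - (phi v / v) - F v.
have ND (v : R) : v < 0 -> is_derive v 1 N (phi v / v ^+ 2).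
  move=> v0; have vn0 : v != 0 by rewrite lt_eqF.
  have := is_derive_normal_pdf01 v; have := FD v => ? ?.
  have dV : is_derive v 1 (fun u : R => u^-1) (- v ^- 2 *: 1).
    exact: (@is_deriveV _ id v 1 1 vn0 (is_derive_id v 1)).
  have dM := is_deriveM (is_derive_normal_pdf01 v) dV.
  have dN := is_deriveB (is_deriveN dM) (FD v).
  by apply: (is_derive_eq dN); rewrite /GRing.scale/=; field.
have NF v : v <= w -> - F v <= N w.
  move=> vw; have v0 : v < 0 by exact: le_lt_trans w0.
  apply: (@le_trans _ _ (N v)).
    rewrite /N lerDr oppr_ge0 mulr_ge0_le0 ?(ltW (normal_pdf01_gt0 _))//.
    by rewrite invr_le0 ltW.
  apply: (ge0_derive_homo vw) => u /andP[_ uw].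
    by apply: ND; exact: le_lt_trans w0.
  by rewrite divr_ge0 ?sqr_ge0// ltW// normal_pdf01_gt0.
have Nw0 : 0 <= N w.
  rewrite -oppr0; apply: (cvgr_to_le (cvgN F0)).
  by near=> v; apply: NF; near: v; apply: nbhs_ninfty_le; exact: num_real.
move: Nw0; rewrite /N subr_ge0 => h.
rewrite mulrC -ler_pdivlMr ?oppr_gt0//.
by rewrite invrN mulrN.
Unshelve. all: by end_near. Qed.

Lemma normal_cdf_mills (w : R) : w < 0 -> - w * Phi w <= phi w.
Proof.
exact: (mills_ratio (@is_derive_normal_cdf R) (@normal_cdf_cvgNy R)).
Qed.

(** Evenness of phi gives the reflected tail the derivative phi as well, so it can replace [Phi] in
    every Mills estimate; the symmetry of [Phi] itself is never proved. *)
Lemma is_derive_normal_cdf_refl (x : R) :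
  is_derive x 1 (fun v => 1 - Phi (- v)) (phi x).
Proof.
have H1 : is_derive x 1 (-%R : R -> R) (- 1).
  exact: is_deriveNid.
have H2 : is_derive (- x) 1 Phi (phi x).
  by rewrite -normal_pdf01N; exact: is_derive_normal_cdf.
have H := @is_derive1_comp _ Phi (-%R) x _ _ H2 H1.
have -> : (fun v => 1 - Phi (- v)) = cst 1 - (Phi \o -%R) by [].
by apply: is_derive_eq; rewrite sub0r mulrN1 opprK.
Qed.

Lemma normal_cdf_refl_mills (w : R) : w < 0 -> - w * (1 - Phi (- w)) <= phi w.
Proof.
apply: (mills_ratio is_derive_normal_cdf_refl).
rewrite -(subrr 1); apply: cvgB; first exact: cvg_cst.
apply: (cvg_comp -%R Phi _ (@normal_cdf_cvgy R)); rewrite ninftyN; exact: cvg_id.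
Qed.

End MillsRatio.

(** * The Stein equation of the normal distribution *)

Section SteinSolution.
Variable R : realType.
Local Notation Phi := (@normal_cdf R).
Local Notation phi := (@normal_pdf R 0 1).

(* The derivative [1 + w M] of the Mills ratio [M = F / phi] lies in [0, 1] for
   [w <= 0] by the Mills inequality; on [w <= K] this makes M and the
   derivative of [w M] of at most linear growth. *)
Section MillsRatioFunction.
Variable F : R -> R.
Hypothesis FD : forall x : R, is_derive x 1 F (phi x).
Hypothesis F0 : forall x, 0 <= F x.
Hypothesis F1 : forall x, F x <= 1.
Hypothesis Fmills : forall w, w < 0 -> - w * F w <= phi w.

Let M w := F w / phi w.

Lemma is_derive_mills (w : R) : is_derive w 1 M (1 + w * M w).
Proof.
have p0 : phi w != 0 by rewrite gt_eqF// normal_pdf01_gt0.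
have dV := @is_deriveV _ phi w _ 1 p0 (is_derive_normal_pdf01 w).
have dM := is_deriveM (FD w) dV.
by apply: (is_derive_eq dM); rewrite /GRing.scale/= /M; field.
Qed.

Lemma is_derive_id_mills (w : R) :
  is_derive w 1 (fun v => v * M v) (M w + w * (1 + w * M w)).
Proof.
have dM := is_deriveM (is_derive_id w 1) (is_derive_mills w).
by apply: (is_derive_eq dM); rewrite /GRing.scale/=; ring.
Qed.

Lemma mills_ge0 w : 0 <= M w.
Proof. by rewrite divr_ge0// ltW// normal_pdf01_gt0. Qed.

Lemma derive_mills_ge0 w : 0 <= 1 + w * M w.
Proof.
have [w0|w0] := ltP w 0; last by rewrite addr_ge0// mulr_ge0// mills_ge0.
rewrite /M mulrA -lerBlDl sub0r lerNl -mulNr -mulNr.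
by rewrite ler_pdivrMr ?normal_pdf01_gt0// mul1r Fmills.
Qed.

Lemma mills_le w K : w <= K -> M w <= (phi K)^-1.
Proof.
move=> wK; apply: (@le_trans _ _ (M K)).
  apply: (ge0_derive_homo wK) => x _; first exact: is_derive_mills.
  exact: derive_mills_ge0.
by rewrite -[leRHS]mul1r ler_wpM2r// invr_ge0 ltW// normal_pdf01_gt0.
Qed.

Lemma derive_id_mills_le K w : 0 <= K -> w <= K ->
  `|M w + w * (1 + w * M w)| <= (1 + (1 + K) / phi K) * (1 + `|w|).
Proof.
move=> K0 wK; have MK := mills_le wK; have M0 := mills_ge0 w.
have dM0 := derive_mills_ge0 w.
have P0 : 0 <= (phi K)^-1 by exact: le_trans M0 MK.
have dM1 : 1 + w * M w <= 1 + K / phi K.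
  rewrite lerD2l; have [w0|w0] := leP w 0.
    by apply: (@le_trans _ _ 0); rewrite ?mulr_le0_ge0// mulr_ge0.
  by rewrite ler_pM// ltW.
have KP : 0 <= K / phi K by rewrite mulr_ge0.
apply: (le_trans (ler_normD _ _)); rewrite (ger0_norm M0) normrM (ger0_norm dM0).
have h : `|w| * (1 + w * M w) <= `|w| * (1 + K / phi K) by rewrite ler_wpM2l.
have w0 : 0 <= `|w| by [].
have : 0 <= `|w| / phi K by rewrite mulr_ge0.
by nra.
Qed.

End MillsRatioFunction.

(** The linear-growth constant of [derive_id_mills_le]. It depends on the point x of the Stein
    equation only through the bound K on |x|. *)
Definition stein_const (K : R) : R := 1 + (1 + K) / phi K.

(** The mean value theorem writes the increment of f as (b - a) (x f x + s) at some x in [a, b].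
    Replacing x by c costs a difference of values of v f v, controlled by a second use of the
    theorem and the growth bound on its derivative g. *)
Lemma stein_step_aux (f g : R -> R) (D s a b c : R) : a <= b -> 0 <= D ->
  (forall w : R, a <= w <= b -> is_derive w 1 f (w * f w + s)) ->
  (forall w : R, a <= w <= b -> is_derive w 1 (fun v => v * f v) (g w)) ->
  (forall w : R, a <= w <= b -> `|g w| <= D * (1 + `|w|)) ->
  a <= c <= b ->
  `|f b - f a - (b - a) * (c * f c + s)| <=
    D * (b - a) ^+ 2 * (1 + `|a| + `|b|).
Proof.
move=> ab D0 fD hD gD /andP[ac cb].
have [x /andP[ax xb] ->] := mvt_closed ab fD.
have -> : (x * f x + s) * (b - a) - (b - a) * (c * f c + s) =
    (b - a) * (x * f x - c * f c) by ring.
have ba0 : 0 <= b - a by rewrite subr_ge0.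
rewrite normrM (ger0_norm ba0).
suff : `|x * f x - c * f c| <= D * (b - a) * (1 + `|a| + `|b|).
  by move=> h; have := ler_wpM2l ba0 h; rewrite expr2 !mulrA [_ * D]mulrC.
wlog xc : x c ax xb ac cb / x <= c.
  move=> W; have [/W|/ltW/W] := leP x c; first exact.
  by rewrite distrC; apply.
have xcD (w : R) : x <= w <= c -> a <= w <= b.
  by move=> /andP[xw wc]; rewrite (le_trans ax)// (le_trans wc).
have [y /xcD/andP[ay yb] E] := mvt_closed xc (fun w h => hD w (xcD w h)).
rewrite distrC E normrM -[leRHS]mulrA [leRHS]mulrCA mulrC.
apply: ler_pM => //.
  by rewrite ger0_norm ?subr_ge0//; lra.
have Y : `|y| <= `|a| + `|b|.
  have [y0|y0] := leP 0 y.
    by rewrite ger0_norm//; have := ler_norm b; have := normr_ge0 a; lra.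
  by rewrite ltr0_norm//; have := ler_norm (- a); rewrite normrN;
    have := normr_ge0 b; lra.
by rewrite (le_trans (gD y _)) ?ay// ler_wpM2l// -addrA lerD2l.
Qed.

(* The Stein equation [f' w = w f w + 1_(w < x) - Phi x], in integrated form on
   an interval that does not straddle [x], where its right-hand side jumps. *)
Lemma stein_solution (K x : R) : `|x| <= K ->
  exists f : R -> R, forall a b c : R, a < b -> b <= x \/ x <= a -> a <= c <= b ->
  `|f b - f a - (b - a) * (c * f c + ((a < x)%R%:R - Phi x))| <=
    stein_const K * (b - a) ^+ 2 * (1 + `|a| + `|b|).
Proof.
move=> xK; have K0 : 0 <= K by exact: le_trans xK.
pose G v := 1 - Phi (- v).
have GD (y : R) : is_derive y 1 G (phi y).
  exact: is_derive_normal_cdf_refl.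
have G0 v : 0 <= G v by rewrite subr_ge0 normal_cdf_le1.
have G1 v : G v <= 1 by rewrite gerBl normal_cdf_ge0.
have Gm : forall w : R, w < 0 -> - w * G w <= phi w.
  exact: normal_cdf_refl_mills.
have PD := @is_derive_normal_cdf R.
have P0 := @normal_cdf_ge0 R; have P1 := @normal_cdf_le1 R.
have Pm := @normal_cdf_mills R.
pose ML w := Phi w / phi w.
pose MR w := G (- w) / phi (- w).
have D0 : 0 <= stein_const K.
  by rewrite addr_ge0// divr_ge0 ?addr_ge0// ltW// normal_pdf01_gt0.
have xKK : - K <= x <= K by rewrite -ler_norml.
have Phix01 : 0 <= 1 - Phi x <= 1.
  by rewrite subr_ge0 P1/= gerBl P0.
(* Left of x this is a multiple of the Mills ratio of the left tail, right of x of that of the right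
   tail. Both branches equal Phi x (1 - Phi x) / phi x at x, so an interval starting at x may use
   the right branch. *)
pose f w := if w <= x then (1 - Phi x) * ML w else Phi x * MR w.
exists f => a b c ab [bx|xa] cab; have ab' := ltW ab.
- have ax : a < x by exact: lt_le_trans bx.
  rewrite ax.
  pose fL w := (1 - Phi x) * ML w.
  pose gL w := (1 - Phi x) * (ML w + w * (1 + w * ML w)).
  have fE w : w <= b -> f w = fL w by move=> wb; rewrite /f (le_trans wb).
  have fD (w : R) : a <= w <= b -> is_derive w 1 fL (w * fL w + (true%:R - Phi x)).
    move=> _; have dM := is_deriveZ (1 - Phi x) (is_derive_mills PD w).
    by apply: (is_derive_eq dM); rewrite /GRing.scale/= /fL /ML; ring.
  have hD (w : R) : a <= w <= b -> is_derive w 1 (fun v => v * fL v) (gL w).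
    move=> _; have dM := is_deriveZ (1 - Phi x) (is_derive_id_mills PD w).
    have -> : (fun v => v * fL v) = (1 - Phi x) \*: (fun v => v * ML v).
      by apply/funext => v; rewrite /= /GRing.scale/= /fL; ring.
    exact: dM.
  have gD (w : R) : a <= w <= b -> `|gL w| <= stein_const K * (1 + `|w|).
    move=> /andP[_ wb]; case/andP: Phix01 => p0 p1.
    rewrite normrM (ger0_norm p0) -[leRHS]mul1r ler_pM//.
    by apply: derive_id_mills_le => //; lra.
  have := stein_step_aux ab' D0 fD hD gD cab.
  by case/andP: cab => _ cb; rewrite !fE.
- have ax : (a < x) = false by apply/negbTE; rewrite -leNgt.
  rewrite ax sub0r.
  pose fR w := Phi x * MR w.
  pose gR w := Phi x * (MR w - w * (1 - w * MR w)).
  have fE w : a <= w -> f w = fR w.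
    move=> aw; rewrite /f; case: ifPn => // wx.
    have -> : w = x by lra.
    by rewrite /fR /ML /MR normal_pdf01N /G opprK; ring.
  have dN (w : R) (h : R -> R) (d : R) : is_derive (- w) 1 h d ->
      is_derive w 1 (fun v => h (- v)) (- d).
    move=> dh; have dN := is_deriveNid w (1 : R).
    by apply: (is_derive_eq (@is_derive1_comp _ h (-%R) w _ _ dh dN)); rewrite mulrN1.
  have fD (w : R) : a <= w <= b -> is_derive w 1 fR (w * fR w + - Phi x).
    move=> _; have dM := is_deriveZ (Phi x) (dN _ _ _ (is_derive_mills GD (- w))).
    by apply: (is_derive_eq dM); rewrite /GRing.scale/= /fR /MR; ring.
  have hD (w : R) : a <= w <= b -> is_derive w 1 (fun v => v * fR v) (gR w).
    move=> _.
    have dM := is_deriveZ (- Phi x) (dN _ _ _ (is_derive_id_mills GD (- w))).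
    have -> : (fun v => v * fR v) =
              (- Phi x) \*: (fun v => - v * (G (- v) / phi (- v))).
      by apply/funext => v; rewrite /= /GRing.scale/= /fR /MR; ring.
    by apply: (is_derive_eq dM); rewrite /GRing.scale/= /gR /MR; ring.
  have gD (w : R) : a <= w <= b -> `|gR w| <= stein_const K * (1 + `|w|).
    move=> /andP[aw wb].
    rewrite normrM (ger0_norm (P0 x)) -[leRHS]mul1r ler_pM//.
    have -> : MR w - w * (1 - w * MR w) =
      G (- w) / phi (- w) + - w * (1 + - w * (G (- w) / phi (- w))).
      by rewrite /MR; ring.
    by rewrite -(normrN w); apply: (derive_id_mills_le GD G0 G1 Gm) => //; lra.
  have := stein_step_aux ab' D0 fD hD gD cab.
  by case/andP: cab => ac _; rewrite !fE.
Qed.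

End SteinSolution.

(** * Binomial distributions *)

Section Binomial.
Variable R : realType.

(* [E f(Z)] for Z binomial(n, p), by conditioning on one trial. *)
Fixpoint binE (p : R) (n : nat) (f : nat -> R) : R :=
  if n is n'.+1 then p * binE p n' (fun k => f k.+1) + (1 - p) * binE p n' f
  else f 0%N.

Lemma binE_ext p n f g : f =1 g -> binE p n f = binE p n g.
Proof. by move=> fg; congr (binE p n _); exact/funext. Qed.

Lemma binED p n f g : binE p n (fun k => f k + g k) = binE p n f + binE p n g.
Proof. by elim: n f g => //= n IH f g; rewrite !IH; ring. Qed.

Lemma binEZ p n c f : binE p n (fun k => c * f k) = c * binE p n f.
Proof. by elim: n f => //= n IH f; rewrite !IH; ring. Qed.

Lemma binE_cst p n c : binE p n (fun=> c) = c.
Proof. by elim: n => //= n ->; ring. Qed.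

Lemma binEB p n f g : binE p n (fun k => f k - g k) = binE p n f - binE p n g.
Proof. by elim: n f g => //= n IH f g; rewrite !IH; ring. Qed.

Variable p : R.
Hypotheses (p0 : 0 < p) (p1 : p < 1).

Lemma binE_le n f g : (forall k, f k <= g k) -> binE p n f <= binE p n g.
Proof.
elim: n f g => //= n IH f g fg.
by rewrite lerD// ler_wpM2l ?IH ?subr_ge0// ltW.
Qed.

Lemma binE_norm_le n f : `|binE p n f| <= binE p n (fun k => `|f k|).
Proof.
rewrite ler_norml -mulN1r -binEZ !binE_le// => k; first exact: ler_norm.
by have := ler_norm (- f k); rewrite normrN; lra.
Qed.

(** The Stein identity of the binomial law. Conditioning on one trial splits off its covariance p (1
    - p) E[f(Z + 1) - f(Z)] and leaves the same identity for the averaged function [ft] with one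
    trial fewer. *)
Lemma binE_stein n f :
  binE p n.+1 (fun k => (k%:R - n.+1%:R * p) * f k) =
  n.+1%:R * p * (1 - p) * binE p n (fun k => f k.+1 - f k).
Proof.
elim: n f => [|n IH] f; first by rewrite /=; ring.
pose ft k := p * f k.+1 + (1 - p) * f k.
have L g : binE p n.+2 g =
  p * binE p n.+1 (fun k => g k.+1) + (1 - p) * binE p n.+1 g by [].
have -> : binE p n.+2 (fun k => (k%:R - n.+2%:R * p) * f k) =
    p * (1 - p) * binE p n.+1 (fun k => f k.+1 - f k) +
    binE p n.+1 (fun k => (k%:R - n.+1%:R * p) * ft k).
  rewrite L -!binEZ -!binED; apply: binE_ext => k.
  by rewrite /ft -!natr1; ring.
rewrite IH; have -> : binE p n (fun k => ft k.+1 - ft k) =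
    binE p n.+1 (fun k => f k.+1 - f k).
  rewrite /= -!binEZ -!binED; apply: binE_ext => k.
  by rewrite /ft; ring.
by rewrite -[n.+2%:R]natr1; ring.
Qed.

Lemma binE_variance n :
  binE p n.+1 (fun k => (k%:R - n.+1%:R * p) ^+ 2) = n.+1%:R * p * (1 - p).
Proof.
under binE_ext do rewrite expr2.
rewrite binE_stein -[RHS]mulr1; congr (_ * _).
rewrite -[RHS](binE_cst p n 1); apply: binE_ext => k.
by rewrite -natr1; ring.
Qed.

(** Both p and 1 - p are at least p (1 - p). Thus the variance over n.+1 trials controls the second
    moments at both ends of a lattice step under n trials. *)
Lemma binE_pair_le n f : (forall k, 0 <= f k) ->
  p * (1 - p) * binE p n (fun k => f k + f k.+1) <= binE p n.+1 f.
Proof.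
move=> f0; rewrite /= -!binEZ -!binED; apply: binE_le => k.
have h0 := f0 k; have h1 := f0 k.+1.
have : 0 <= p * p * f k.+1 by rewrite !mulr_ge0// ltW.
have : 0 <= (1 - p) * (1 - p) * f k.
  by rewrite !mulr_ge0// subr_ge0 ltW.
by nra.
Qed.

(* The Stein identity trades n.+1 trials for n: the distribution function is that
   of n trials, its normalisation that of n.+1.  As x is a lattice point, no step
   of the lattice straddles it and no smoothing of the indicator is needed. *)
Lemma binomial_berry_esseen (K : R) : 0 <= K ->
  exists2 C : R, 0 < C & forall (n m : nat) (x : R), `|x| <= K ->
    m%:R = n.+1%:R * p + Num.sqrt (n.+1%:R * p * (1 - p)) * x ->
    `|binE p n (fun k => (k < m)%N%:R) - normal_cdf x| <= C / Num.sqrt n.+1%:R.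
Proof.
move=> K0; pose D := stein_const K.
have D0 : 0 < D.
  by rewrite /D ltr_pwDl// divr_ge0 ?addr_ge0// ltW// normal_pdf01_gt0.
have pq0 : 0 < p * (1 - p) by rewrite mulr_gt0// subr_gt0.
(* [C1] bounds the mean of 1 + |w k| + |w k.+1|: use |w| <= (1 + w^2)/2, then [binE_pair_le] and the
   variance, by which the two squares have total mean at most 1/(p (1 - p)). *)
pose C1 := 2 + (2 * (p * (1 - p)))^-1.
have C10 : 0 < C1 by rewrite addr_gt0// invr_gt0 mulr_gt0.
exists (D * C1 / Num.sqrt (p * (1 - p))).
  by rewrite divr_gt0 ?mulr_gt0// sqrtr_gt0.
move=> n m x xK.
set s := Num.sqrt (n.+1%:R * p * (1 - p)) => mE.
have s20 : 0 < n.+1%:R * p * (1 - p) by rewrite -mulrA mulr_gt0.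
have s0 : 0 < s by rewrite sqrtr_gt0.
have s2 : s ^+ 2 = n.+1%:R * p * (1 - p) by rewrite sqr_sqrtr// ltW.
have sn0 : s != 0 by rewrite gt_eqF.
have -> : D * C1 / Num.sqrt (p * (1 - p)) / Num.sqrt n.+1%:R = D * C1 / s.
  have -> : s = Num.sqrt (p * (1 - p)) * Num.sqrt n.+1%:R.
    by rewrite -sqrtrM ?(ltW pq0)// /s; congr Num.sqrt; ring.
  by rewrite invfM mulrA.
pose w (k : nat) : R := (k%:R - n.+1%:R * p) / s.
have wS k : w k.+1 = w k + s^-1 by rewrite /w -natr1; ring.
have xw : x = w m by rewrite /w mE; field.
have wlt k l : (w k < w l) = (k < l)%N.
  by rewrite /w ltr_pM2r ?invr_gt0// ltrD2r ltr_nat.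
have [f fS] := stein_solution xK.
have {}fS k c : w k <= c <= w k.+1 ->
    `|s ^+ 2 * (f (w k.+1) - f (w k)) -
      s * (c * f c + ((k < m)%N%:R - normal_cdf x))| <=
    D * (1 + `|w k| + `|w k.+1|).
  move=> kc; have wkk : w k < w k.+1 by rewrite wlt.
  have cond : w k.+1 <= x \/ x <= w k.
    rewrite xw [w m <= _]leNgt [w k.+1 <= _]leNgt !wlt -!leqNgt.
    by case: (leqP m k) => [|]; [right|left].
  have := fS _ _ _ wkk cond kc.
  rewrite xw wlt -xw.
  have -> : w k.+1 - w k = s^-1 by rewrite wS; ring.
  move=> h.
  have s2p : 0 <= s ^+ 2 by exact: sqr_ge0.
  have := ler_wpM2l s2p h.
  rewrite -[X in X * `|_|](ger0_norm s2p) -normrM.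
  have -> : s ^+ 2 * (stein_const K * s^-1 ^+ 2 * (1 + `|w k| + `|w k.+1|)) =
            D * (1 + `|w k| + `|w k.+1|) by rewrite /D; field.
  congr (`|_| <= _); first by field.
(* In the Stein identity the last trial puts the value at [w k.+1] with probability p and at [w k]
   with probability 1 - p. The error is therefore the mean of the local errors [fS] with c at the
   right and at the left end of the step. *)
have key : s * (binE p n (fun k => (k < m)%N%:R) - normal_cdf x) =
    - binE p n (fun k =>
        p * (s ^+ 2 * (f (w k.+1) - f (w k)) -
          s * (w k.+1 * f (w k.+1) + ((k < m)%N%:R - normal_cdf x))) +
        (1 - p) * (s ^+ 2 * (f (w k.+1) - f (w k)) -
          s * (w k * f (w k) + ((k < m)%N%:R - normal_cdf x)))) .
  have E := binE_stein n (fun k => f (w k)).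
  rewrite -s2 -binEZ in E.
  have E' : binE p n.+1 (fun k => (k%:R - n.+1%:R * p) * f (w k)) =
    binE p n (fun k => s * (p * (w k.+1 * f (w k.+1)) + (1 - p) * (w k * f (w k)))).
    rewrite /= -!binEZ -!binED; apply: binE_ext => k.
    by rewrite /w; field.
  rewrite E' in E.
  have E2 : binE p n (fun k => (k < m)%N%:R) - normal_cdf x =
      binE p n (fun k => (k < m)%N%:R - normal_cdf x).
    by rewrite binEB binE_cst.
  apply/eqP; rewrite -subr_eq0 opprK E2 -binEZ -binED.
  rewrite -(subrr (binE p n (fun k => s ^+ 2 * (f (w k.+1) - f (w k))))) -{2}E.
  by rewrite -binEB; apply/eqP/binE_ext => k; ring.
have bound : `|s * (binE p n (fun k => (k < m)%N%:R) - normal_cdf x)| <=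
    D * binE p n (fun k => 1 + `|w k| + `|w k.+1|).
  rewrite key normrN (le_trans (binE_norm_le _ _))// -binEZ.
  apply: binE_le => k; have kk : w k <= w k.+1 by rewrite ltW// wlt.
  apply: (le_trans (ler_normD _ _)).
  rewrite !normrM (gtr0_norm p0) [`|1 - p|]gtr0_norm ?subr_gt0//.
  have h1 : w k <= w k.+1 <= w k.+1 by rewrite kk lexx.
  have h2 : w k <= w k <= w k.+1 by rewrite kk lexx.
  have q0 : 0 <= 1 - p by rewrite subr_ge0 ltW.
  have := ler_wpM2l (ltW p0) (fS k _ h1).
  have := ler_wpM2l q0 (fS k _ h2).
  by rewrite -!normrM; lra.
have W2 : binE p n (fun k => w k ^+ 2 + w k.+1 ^+ 2) <= (p * (1 - p))^-1.
  rewrite -[leRHS]mul1r ler_pdivlMr// mulrC.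
  apply: (le_trans (binE_pair_le n (fun k => sqr_ge0 (w k)))).
  have -> : binE p n.+1 (fun k => w k ^+ 2) =
      (s ^+ 2)^-1 * binE p n.+1 (fun k => (k%:R - n.+1%:R * p) ^+ 2).
    by rewrite -binEZ; apply: binE_ext => k; rewrite /w; field.
  by rewrite binE_variance -s2 mulVf// sqrf_eq0.
have W1 : binE p n (fun k => 1 + `|w k| + `|w k.+1|) <= C1.
  apply: (@le_trans _ _ (binE p n (fun k => 2 + 2^-1 * (w k ^+ 2 + w k.+1 ^+ 2)))).
    apply: binE_le => k; rewrite -(real_normK (num_real (w k))).
    rewrite -(real_normK (num_real (w k.+1))).
    have := sqr_ge0 (`|w k| - 1); have := sqr_ge0 (`|w k.+1| - 1).
    by nra.
  rewrite binED binE_cst binEZ /C1 lerD2l invfM ler_wpM2l//.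
have := le_trans bound (ler_wpM2l (ltW D0) W1).
by rewrite normrM (gtr0_norm s0) ler_pdivlMr// mulrC.
Qed.

End Binomial.

(** * Location of the binomial quantile *)

Section BinomialQuantile.
Variable R : realType.
Local Notation Phi := (@normal_cdf R).
Local Notation phi := (@normal_pdf R 0 1).

(** The limits at both ends and the intermediate value theorem give a preimage, so the default value
    0 of [xget] does not occur. *)
Lemma normal_cdf_invK (e : R) : 0 < e -> e < 1 -> Phi (normal_cdf_inv e) = e.
Proof.
move=> e0 e1; rewrite /normal_cdf_inv.
case: xgetP => [x _ //|nox]; exfalso.
have [a aE] : exists a, Phi a <= e.
  exact: (filter_ex (cvgr_le _ (@normal_cdf_cvgNy R) _ e0)).
have [b bE] : exists b, e <= Phi b.
  exact: (filter_ex (cvgr_ge _ (@normal_cdf_cvgy R) _ e1)).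
have [ab|/ltW ba] := leP a b; last first.
  by apply: (nox a); apply/le_anti; rewrite aE (le_trans bE)// normal_cdf_homo.
have cP : {within `[a, b], continuous Phi}.
  apply: derivable_within_continuous => x _.
  by have [] := @is_derive_normal_cdf R x.
have [|c _ cE] := IVT ab cP (v := e); last by apply: (nox c).
by rewrite ge_min le_max aE bE orbT.
Qed.

Lemma sqrt_nat_large (U : R) : exists N, forall n, (N <= n)%N ->
  U <= Num.sqrt n.+1%:R.
Proof.
exists (Num.truncn (U ^+ 2)) => n Nn.
rewrite (le_trans (ler_norm U))// -sqrtr_sqr ler_sqrt ?ltr0n//.
by rewrite (le_trans (ltW (truncnS_gt _)))// ler_nat.
Qed.

Lemma normal_cdf_increase (K x y : R) : - K <= x -> x <= y -> y <= K ->
  phi K * (y - x) <= Phi y - Phi x.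
Proof.
move=> Kx xy yK.
have [c /andP[xc cy] ->] := mvt_closed xy (fun z _ => is_derive_normal_cdf z).
rewrite ler_wpM2r ?subr_ge0//.
by apply: normal_pdf01_homo; nra.
Qed.

Variables (p eps : R).
Hypotheses (p0 : 0 < p) (p1 : p < 1) (eps0 : 0 < eps) (eps1 : eps < 1).

Lemma sqrtS_sqrt_le1 (n : nat) : 0 <= Num.sqrt n.+1%:R - Num.sqrt (n%:R : R) <= 1.
Proof.
have h : Num.sqrt n%:R <= Num.sqrt n.+1%:R :> R by rewrite ler_wsqrtr// ler_nat.
rewrite subr_ge0 h/= lerBlDl -(@ler_pXn2r _ 2) ?nnegrE ?addr_ge0 ?sqrtr_ge0//.
have := sqrtr_ge0 (n%:R : R).
by rewrite sqrrD !sqr_sqrtr ?ler0n// -natr1; nra.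
Qed.

(** Displacing the normal quantile by a / sqrt(n + 1) changes [Phi] by at least (B + C) / sqrt(n +
    1), which pays for the Berry-Esseen error and the perturbation B. On the integer scale, where
    the deviation is of order sqrt(n + 1), this is a shift of order 1. *)
Lemma binomial_quantile (B : R) : 0 <= B ->
  exists (A : R) (N : nat), forall n : nat, (N <= n)%N ->
  (exists m : nat,
    n%:R * p + Num.sqrt (n%:R * (p * (1 - p))) * normal_cdf_inv eps - A <= m%:R /\
    binE p n (fun k => (k < m)%N%:R) <= eps - B / Num.sqrt n.+1%:R) /\
  (exists m : nat,
    m%:R <= n%:R * p + Num.sqrt (n%:R * (p * (1 - p))) * normal_cdf_inv eps + A /\
    eps + B / Num.sqrt n.+1%:R <= binE p n (fun k => (k < m)%N%:R)).
Proof.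
move=> B0; set x0 := normal_cdf_inv eps.
have x0E : Phi x0 = eps by exact: normal_cdf_invK.
pose K := `|x0| + 1.
have K0 : 0 <= K by rewrite addr_ge0.
have [C C0 BE] := binomial_berry_esseen p0 p1 K0.
have c0 : 0 < phi K by exact: normal_pdf01_gt0.
pose a := (B + C) / phi K.
have a0 : 0 < a by rewrite divr_gt0// ltr_wpDl.
pose r := Num.sqrt (p * (1 - p)).
have pq0 : 0 < p * (1 - p) by rewrite mulr_gt0// subr_gt0.
have r0 : 0 < r by rewrite sqrtr_gt0.
have r1 : r <= 1.
  by rewrite -sqrtr1 ler_wsqrtr//; nra.
(* The terms a and 1/r keep the displaced and rounded point within K = |x0| + 1; K / p makes the
   targets nonnegative, so that they can be rounded to natural numbers. *)
have [N NU] := sqrt_nat_large (a + r^-1 + K / p).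
(* |x0| pays for sqrt n against sqrt(n + 1), a for the displacement, and 2 for the rounding and for
   the mean (n + 1) p against n p. *)
exists (`|x0| + a + 2), N => n /NU; set u := Num.sqrt n.+1%:R => uU.
have Kp : 0 <= K / p by rewrite divr_ge0// ltW.
have ri : 0 < r^-1 by rewrite invr_gt0.
have u0 : 0 < u by rewrite sqrtr_gt0 ltr0n.
have uK : r * K <= u * p.
  apply: (@le_trans _ _ K); first by rewrite ler_piMl.
  by rewrite -ler_pdivrMr//; lra.
have ua : a / u + r^-1 / u <= 1 by rewrite -mulrDl ler_pdivrMr// mul1r; lra.
have au : 0 < a / u by rewrite divr_gt0.
have ru : 0 < r^-1 / u by rewrite divr_gt0.
have u2 : u ^+ 2 = n.+1%:R by rewrite sqr_sqrtr.
pose s := Num.sqrt (n.+1%:R * p * (1 - p)).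
have sE : s = u * r by rewrite /s -mulrA sqrtrM.
have s0 : 0 < s by rewrite sE mulr_gt0.
have snE : Num.sqrt (n%:R * (p * (1 - p))) = Num.sqrt n%:R * r by rewrite sqrtrM.
have su : s^-1 = r^-1 / u by rewrite sE invfM mulrC.
have [xK1 xK2] : - K + 1 <= x0 /\ x0 <= K - 1.
  by have := ler_norm x0; have := ler_norm (- x0); rewrite normrN /K; split; lra.
have mono (y z : R) : - K <= y -> y <= z -> z <= K -> z - y = a / u ->
    (B + C) / u <= Phi z - Phi y.
  move=> h1 h2 h3 h4; rewrite (le_trans _ (normal_cdf_increase h1 h2 h3))// h4.
  by rewrite /a mulrA [phi K * _]mulrC divfK ?gt_eqF.
have /andP[un0 un1] := sqrtS_sqrt_le1 n; rewrite -/u in un0 un1.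
have rx : `|(u - Num.sqrt n%:R) * r * x0| <= `|x0|.
  rewrite normrM ler_piMl// normrM (ger0_norm un0) (gtr0_norm r0).
  by rewrite -[leRHS]mulr1 ler_pM// ltW.
have /andP[rx1 rx2] : - `|x0| <= (u - Num.sqrt n%:R) * r * x0 <= `|x0|.
  by rewrite -ler_norml.
have nS : n.+1%:R * p = n%:R * p + p by rewrite -natr1; ring.
have mean_ge0 (y : R) : - K <= y -> 0 <= n.+1%:R * p + s * y.
  move=> yK; rewrite -u2 sE expr2.
  have -> : u * u * p + u * r * y = u * (u * p + r * y) by ring.
  by rewrite mulr_ge0 ?(ltW u0)//; nra.
have lattice (m : nat) : exists x : R, m%:R = n.+1%:R * p + s * x.
  by exists ((m%:R - n.+1%:R * p) / s); field; rewrite gt_eqF.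
have seu (y : R) : s * (y / u) = r * y.
  by rewrite sE; field; rewrite gt_eqF.
split.
- pose y := x0 - a / u.
  have yK : - K <= y by move: xK1 ua au ru; rewrite /y; clear; lra.
  have /truncn_itv/andP[m1 m2] := mean_ge0 _ yK.
  set m := Num.truncn _ in m1 m2; exists m; split.
    apply: (@le_trans _ _ (n.+1%:R * p + s * y - 1)); last first.
      by move: m2; rewrite -[m.+1%:R]natr1; clear; lra.
    rewrite snE nS /y mulrBr seu sE.
    have : r * a <= a by rewrite ler_piMl// ltW.
    move: p0 a0 rx1; rewrite !mulrBl.
    move: (u * r * x0) (Num.sqrt n%:R * r * x0) (r * a) (n%:R * p) => X Y Z W.
    by clear; lra.
  have [x xE] := lattice m.
  have xy : x <= y by rewrite -(ler_pM2l s0); move: m1; rewrite xE; clear; lra.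
  have yx : y - s^-1 <= x.
    rewrite -(ler_pM2l s0) mulrBr mulfV ?gt_eqF//; move: m2.
    by rewrite -[m.+1%:R]natr1 xE; clear; lra.
  have xK : `|x| <= K.
    by rewrite ler_norml; move: yx xy ua au ru xK1 xK2; rewrite su /y; clear;
      move=> *; apply/andP; split; lra.
  have := BE n m x xK xE; rewrite -/u ler_norml => /andP[_ h].
  have h2 : (B + C) / u <= Phi x0 - Phi y.
    by apply: mono => //; move: xK1 xK2 ua au ru; rewrite /y; clear; lra.
  have h3 := normal_cdf_homo xy.
  by move: h2 h h3; rewrite mulrDl x0E; clear; lra.
- pose y := x0 + a / u.
  have yK : - K <= y by move: xK1 ua au ru; rewrite /y; clear; lra.
  have /truncn_itv/andP[m1 m2] := mean_ge0 _ yK.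
  set m := Num.truncn _ in m1 m2; exists m.+1; split.
    apply: (@le_trans _ _ (n.+1%:R * p + s * y + 1)).
      by rewrite -[m.+1%:R]natr1 lerD2r.
    rewrite snE nS /y mulrDr seu sE.
    have : r * a <= a by rewrite ler_piMl// ltW.
    move: p1 a0 rx2; rewrite !mulrBl.
    move: (u * r * x0) (Num.sqrt n%:R * r * x0) (r * a) (n%:R * p) => X Y Z W.
    by clear; lra.
  have [x xE] := lattice m.+1.
  have xy : y <= x by rewrite -(ler_pM2l s0); move: m2; rewrite xE; clear; lra.
  have yx : x <= y + s^-1.
    rewrite -(ler_pM2l s0) mulrDr mulfV ?gt_eqF//; move: m1.
    by move: xE; rewrite -[m.+1%:R]natr1; clear; lra.
  have xK : `|x| <= K.
    by rewrite ler_norml; move: yx xy ua au ru xK1 xK2; rewrite su /y; clear;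
      move=> *; apply/andP; split; lra.
  have := BE n m.+1 x xK xE; rewrite -/u ler_norml => /andP[h _].
  have h2 : (B + C) / u <= Phi y - Phi x0.
    by apply: mono => //; move: xK1 xK2 ua au ru; rewrite /y; clear; lra.
  have h3 := normal_cdf_homo xy.
  by move: h2 h h3; rewrite mulrDl x0E; clear; lra.
Qed.

End BinomialQuantile.

(** * Positive semidefinite matrices and local operations *)

Section PositiveSemidefinite.
Variable R : realType.
Local Notation C := (complex R).

Lemma adjmxD m n (A B : 'M[C]_(m, n)) : adjmx (A + B) = adjmx A + adjmx B.
Proof. by rewrite /adjmx linearD map_mxD. Qed.

Lemma adjmxZ m n (c : C) (A : 'M[C]_(m, n)) :
  adjmx (c *: A) = Num.conj c *: adjmx A.
Proof. by rewrite /adjmx linearZ map_mxZ. Qed.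

Lemma adjmxM m n k (A : 'M[C]_(m, n)) (B : 'M[C]_(n, k)) :
  adjmx (A *m B) = adjmx B *m adjmx A.
Proof. by rewrite /adjmx trmx_mul map_mxM. Qed.

Lemma adjmxK m n (A : 'M[C]_(m, n)) : adjmx (adjmx A) = A.
Proof. by apply/matrixP => i j; rewrite !mxE conjCK. Qed.

Lemma adjmx_tens m n k l (A : 'M[C]_(m, n)) (B : 'M[C]_(k, l)) :
  adjmx (A *t B) = adjmx A *t adjmx B.
Proof. by rewrite /adjmx trmx_tens map_mxT. Qed.

Lemma psdmx_conj m n (K : 'M[C]_(m, n)) (A : 'M[C]_n) :
  psdmx A -> psdmx (K *m A *m adjmx K).
Proof.
move=> A0 v; have := A0 (adjmx K *m v).
by rewrite adjmxM adjmxK !mulmxA.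
Qed.

Lemma psdmx0 n : psdmx (0 : 'M[C]_n).
Proof. by move=> v; rewrite mulmx0 mul0mx mxE. Qed.

Lemma psdmxD n (A B : 'M[C]_n) : psdmx A -> psdmx B -> psdmx (A + B).
Proof. by move=> A0 B0 v; rewrite mulmxDr mulmxDl mxE addr_ge0. Qed.

Lemma psdmxZ n (c : C) (A : 'M[C]_n) : 0 <= c -> psdmx A -> psdmx (c *: A).
Proof. by move=> c0 A0 v; rewrite -scalemxAr -scalemxAl mxE mulr_ge0. Qed.

Lemma psdmx_sum n (I : finType) (F : I -> 'M[C]_n) :
  (forall i, psdmx (F i)) -> psdmx (\sum_i F i).
Proof. by move=> F0; apply: big_ind => //; [exact: psdmx0|exact: psdmxD]. Qed.

Lemma psdmx_gram m n (K : 'M[C]_(m, n)) : psdmx (K *m adjmx K).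
Proof.
move=> v; set w := adjmx K *m v.
have -> : adjmx v *m (K *m adjmx K) *m v = adjmx w *m w.
  by rewrite /w adjmxM adjmxK !mulmxA.
rewrite mxE sumr_ge0// => k _; rewrite !mxE mulrC.
exact: mul_conjC_ge0.
Qed.

Lemma psdmx_proj_of n (v : 'cV[C]_n) : psdmx (proj_of v).
Proof. exact: psdmx_gram. Qed.

Lemma psdmx_tr n (A : 'M[C]_n) : psdmx A -> psdmx A^T.
Proof.
move=> A0 v; have := A0 (map_mx Num.conj v).
set u := map_mx _ v => uA.
have -> : adjmx v *m A^T *m v = (adjmx u *m A *m u)^T.
  rewrite !trmx_mul mulmxA; congr (_ *m _ *m _).
    by apply/matrixP => i j; rewrite !mxE.
  by apply/matrixP => i j; rewrite !mxE conjCK.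
by rewrite mxE.
Qed.

Lemma psdmx_mxsub m n (f : 'I_m -> 'I_n) (A : 'M[C]_n) :
  psdmx A -> psdmx (mxsub f f A).
Proof.
move=> A0; have -> : mxsub f f A = rowsub f 1%:M *m A *m adjmx (rowsub f 1%:M).
  have -> : adjmx (rowsub f 1%:M) = colsub f 1%:M :> 'M[C]_(n, m).
    by apply/matrixP => i j; rewrite !mxE eq_sym; case: eqP;
      rewrite ?conjC0 ?conjC1.
  by rewrite mul_rowsub_mx mul1mx mulmx_colsub mulmx1 /mxsub;
    apply/matrixP => i j; rewrite !mxE.
exact: psdmx_conj.
Qed.

Lemma sandwich_delta n (A : 'M[C]_n) i j (k l : 'I_1) :
  (adjmx (delta_mx i 0 : 'cV[C]_n) *m A *m delta_mx j 0) k l = A i j.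
Proof.
rewrite !ord1.
have -> : adjmx (delta_mx i 0 : 'cV[C]_n) = delta_mx 0 i.
  apply/matrixP => a b; rewrite !mxE [in RHS]andbC.
  by case: (_ && _); rewrite ?conjC0 ?conjC1.
by rewrite -rowE -colE !mxE.
Qed.

(** The quadratic form at e_i + c e_j. The choice c = -1 bounds the off-diagonal entries; c = 1 and
    c = i together show hermiticity. *)
Lemma psdmx_pair n (A : 'M[C]_n) i j (c : C) : psdmx A ->
  0 <= A i i + Num.conj c * A j i + (c * A i j + c * Num.conj c * A j j).
Proof.
move=> /(_ (delta_mx i 0 + c *: delta_mx j 0)).
have addE (X Y : 'M[C]_1) : (X + Y) 0 0 = X 0 0 + Y 0 0 by rewrite mxE.
have scaleE a (X : 'M[C]_1) : (a *: X) 0 0 = a * X 0 0 by rewrite mxE.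
rewrite adjmxD adjmxZ !(mulmxDr, mulmxDl) -!(scalemxAl, scalemxAr).
by rewrite !(addE, scaleE) !sandwich_delta [c * _ * _]mulrAC [c * A j j * _]mulrC.
Qed.

Lemma psdmx_diag_ge0 n (A : 'M[C]_n) i : psdmx A -> 0 <= A i i.
Proof. by move=> /(_ (delta_mx i 0)); rewrite sandwich_delta. Qed.

Lemma psdmx_offdiag n (A : 'M[C]_n) i j : psdmx A ->
  A i j + A j i <= A i i + A j j.
Proof.
move=> /(psdmx_pair i j (-1)); rewrite rmorphN1 => h; rewrite -subr_ge0.
by move: h; congr (is_true (0 <= _)); ring.
Qed.

Lemma psdmx_hermitian n (A : 'M[C]_n) : psdmx A -> adjmx A = A.
Proof.
move=> A0; apply/matrixP => i j; rewrite !mxE.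
have := psdmx_pair i j 1 A0; have := psdmx_pair i j 'i A0.
have := psdmx_diag_ge0 i A0; have := psdmx_diag_ge0 j A0.
rewrite !conjC1 conjCi -!complexiE !lecE.
case: (A i i) => a1 a2; case: (A j j) => b1 b2.
case: (A i j) => c1 c2; case: (A j i) => d1 d2.
rewrite /=; simpc => /=.
move=> /andP[/eqP-> _] /andP[/eqP-> _] /andP[/eqP h1 _] /andP[/eqP h2 _].
by congr Complex; lra.
Qed.

(** The spectral theorem, with square roots of the nonnegative eigenvalues. The factorisation is
    what makes tensor products of positive matrices positive. *)
Lemma psdmx_factor n (A : 'M[C]_n) : psdmx A ->
  exists K : 'M[C]_n, A = K *m adjmx K.
Proof.
move=> A0; pose P := spectralmx A; pose d := spectral_diag A.
have PU : P \is unitarymx by exact: spectral_unitarymx.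
have AE : A = adjmx P *m diag_mx d *m P.
  rewrite [adjmx P](_ : _ = invmx P); last by rewrite invmx_unitary.
  apply/orthomx_spectralP/hermitian_normalmx/is_hermitianmxP.
  by rewrite expr0 scale1r; exact/esym/psdmx_hermitian.
have PK : P *m adjmx P = 1%:M by exact/unitarymxP.
have dE : diag_mx d = P *m A *m adjmx P.
  by rewrite AE !mulmxA PK mul1mx -mulmxA PK mulmx1.
have d0 k : 0 <= d 0 k.
  have := psdmx_diag_ge0 k (psdmx_conj P A0).
  by rewrite -dE mxE eqxx mulr1n.
exists (adjmx P *m diag_mx (map_mx sqrtC d)).
rewrite adjmxM adjmxK {1}AE -!mulmxA; congr (_ *m _).
rewrite !mulmxA; congr (_ *m _); apply/matrixP => i j.
rewrite mul_diag_mx !mxE; case: eqVneq => [->|ij].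
  rewrite ?eqxx !mulr1n geC0_conj ?sqrtC_ge0//.
  by rewrite -expr2 sqrtCK.
by rewrite ?[j == i]eq_sym ?(negbTE ij) !mulr0n conjC0 mulr0.
Qed.

Lemma psdmx_tens m n (A : 'M[C]_m) (B : 'M[C]_n) :
  psdmx A -> psdmx B -> psdmx (A *t B).
Proof.
move=> /psdmx_factor[K ->] /psdmx_factor[L ->].
by rewrite -tensmx_mul -adjmx_tens; exact: psdmx_gram.
Qed.

End PositiveSemidefinite.

(** * Positivity of partial transposes under the four classes *)

Section LocalOperations.
Variable R : realType.
Local Notation C := (complex R).

Lemma sum_mxtens_index (V : nmodType) m n (F : 'I_(m * n) -> V) :
  \sum_s F s = \sum_i \sum_j F (mxtens_index (i, j)).
Proof.
rewrite pair_bigA (reindex (fun p => mxtens_index p))/=; last first.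
  by exists (@mxtens_unindex m n) => s _; [exact: mxtens_indexK|exact: mxtens_unindexK].
by apply: eq_bigr => -[].
Qed.

Lemma linear_sumZ a b (E : 'M[C]_a -> 'M[C]_b) : linear E ->
  forall (I : finType) (c : I -> C) (X : I -> 'M[C]_a),
  E (\sum_i c i *: X i) = \sum_i c i *: E (X i).
Proof.
move=> linE I c X.
pose f : {linear 'M[C]_a -> 'M[C]_b} := HB.pack E (GRing.isLinear.Build _ _ _ _ E linE).
rewrite -[E]/(f : _ -> _) linear_sum; apply: eq_bigr => i _.
by rewrite linearZ.
Qed.

Lemma matrix_sum_deltaZ m n (A : 'M[C]_(m, n)) :
  A = \sum_(ij : 'I_m * 'I_n) A ij.1 ij.2 *: delta_mx ij.1 ij.2.
Proof. by rewrite [LHS]matrix_sum_delta pair_bigA. Qed.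

Lemma delta_mx_tens m n p q (i : 'I_m) (j : 'I_n) (k : 'I_p) (l : 'I_q) :
  delta_mx (mxtens_index (i, k)) (mxtens_index (j, l)) =
  delta_mx i j *t delta_mx k l :> 'M[C]_(m * p, n * q).
Proof.
apply/matrixP => s t.
case: (mxtens_indexP s) => s1 s2; case: (mxtens_indexP t) => t1 t2.
rewrite tensmxE !mxE !(can_eq (@mxtens_indexK _ _)) !xpair_eqE -natrM mulnb.
by rewrite andbACA.
Qed.

Lemma tensmx_suml (I : finType) m n p q (A : I -> 'M[C]_(m, n)) (B : 'M[C]_(p, q)) :
  (\sum_i A i) *t B = \sum_i A i *t B.
Proof.
apply/matrixP => s t; rewrite !(mxE, summxE) mulr_suml.
by apply: eq_bigr => i _; rewrite mxE.
Qed.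

Lemma tensmx_sumr (I : finType) m n p q (A : 'M[C]_(m, n)) (B : I -> 'M[C]_(p, q)) :
  A *t (\sum_i B i) = \sum_i A *t B i.
Proof.
apply/matrixP => s t; rewrite !(mxE, summxE) mulr_sumr.
by apply: eq_bigr => i _; rewrite mxE.
Qed.

Lemma tensmxZl m n p q (c : C) (A : 'M[C]_(m, n)) (B : 'M[C]_(p, q)) :
  (c *: A) *t B = c *: (A *t B).
Proof. by apply/matrixP => s t; rewrite !mxE mulrA. Qed.

Lemma tensmxZr m n p q (c : C) (A : 'M[C]_(m, n)) (B : 'M[C]_(p, q)) :
  A *t (c *: B) = c *: (A *t B).
Proof. by apply/matrixP => s t; rewrite !mxE mulrCA. Qed.

Lemma tensmapE a b a' b' (E : 'M[C]_a -> 'M[C]_a') (F : 'M[C]_b -> 'M[C]_b')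
    (A : 'M[C]_a) (B : 'M[C]_b) : linear E -> linear F ->
  tensmap E F (A *t B) = E A *t F B.
Proof.
move=> linE linF.
rewrite [in RHS](matrix_sum_deltaZ A) [in RHS](matrix_sum_deltaZ B).
rewrite (linear_sumZ linE) (linear_sumZ linF) tensmx_suml -(pair_bigA _ (fun i j =>
  (A i j *: E (delta_mx i j)) *t _)).
rewrite /tensmap sum_mxtens_index; apply: eq_bigr => i _.
under [LHS]eq_bigr => k _ do rewrite sum_mxtens_index.
rewrite exchange_big; apply: eq_bigr => j _.
rewrite tensmx_sumr -(pair_bigA _ (fun k l =>
  _ *t (B k l *: F (delta_mx k l)))).
apply: eq_bigr => k _; apply: eq_bigr => l _.
by rewrite tensmxE !mxtens_indexK tensmxZl tensmxZr scalerA.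
Qed.

Lemma linear_idfun n : linear (@idfun 'M[C]_n). Proof. by []. Qed.

(** Complete positivity with an ancilla of dimension 1, followed by the relabelling of C^1 tensor
    C^b as C^b. *)
Lemma cp_psdmx a b (E : 'M[C]_a -> 'M[C]_b) (A : 'M[C]_a) :
  cp E -> psdmx A -> psdmx (E A).
Proof.
move=> [linE cpE] A0.
have I0 : psdmx (1%:M : 'M[C]_1).
  by rewrite -[1%:M]mulmx1 -[X in _ *m X](_ : adjmx 1%:M = 1%:M); 
    [exact: psdmx_gram|rewrite /adjmx trmx1 map_mx1].
have := cpE 1 _ (psdmx_tens I0 A0); rewrite (tensmapE _ _ (@linear_idfun _) linE).
move=> /(psdmx_mxsub (fun i : 'I_b => mxtens_index (0 : 'I_1, i))).
congr psdmx; apply/matrixP => i j.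
by rewrite mxE tensmxE !mxE mul1r.
Qed.

Lemma partial_transposeE a b (X : 'M[C]_(a * b)) i j k l :
  partial_transpose X (mxtens_index (i, j)) (mxtens_index (k, l)) =
  X (mxtens_index (i, l)) (mxtens_index (k, j)).
Proof. by rewrite mxE !mxtens_indexK. Qed.

Lemma partial_transpose_tens a b (A : 'M[C]_a) (B : 'M[C]_b) :
  partial_transpose (A *t B) = A *t B^T.
Proof.
apply/matrixP => s t.
case: (mxtens_indexP s) => s1 s2; case: (mxtens_indexP t) => t1 t2.
by rewrite partial_transposeE !tensmxE mxE.
Qed.

Lemma partial_transpose_sum a b (I : finType) (X : I -> 'M[C]_(a * b)) :
  partial_transpose (\sum_i X i) = \sum_i partial_transpose (X i).
Proof.
apply/matrixP => s t; rewrite mxE !summxE.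
by apply: eq_bigr => i _; rewrite mxE.
Qed.

Lemma partial_transposeZ a b (c : C) (X : 'M[C]_(a * b)) :
  partial_transpose (c *: X) = c *: partial_transpose X.
Proof. by apply/matrixP => s t; rewrite !mxE. Qed.

Lemma regroupE a b a' b' (X : 'M[C]_((a * b) * (a' * b'))) i i' j j' k k' l l' :
  regroup X (mxtens_index (mxtens_index (i, i'), mxtens_index (j, j')))
            (mxtens_index (mxtens_index (k, k'), mxtens_index (l, l'))) =
  X (mxtens_index (mxtens_index (i, j), mxtens_index (i', j')))
    (mxtens_index (mxtens_index (k, l), mxtens_index (k', l'))).
Proof. by rewrite mxE /swap_index !mxtens_indexK. Qed.

Lemma choiE m n (E : 'M[C]_m -> 'M[C]_n) s t x y :
  choi E (mxtens_index (s, x)) (mxtens_index (t, y)) = E (delta_mx s t) x y.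
Proof.
rewrite /choi summxE (bigD1 s)//= [X in _ + X]big1 ?addr0 => [|s' s's].
  rewrite summxE (bigD1 t)//= [X in _ + X]big1 ?addr0 => [|t' t't].
    by rewrite tensmxE mxE !eqxx mul1r.
  by rewrite tensmxE mxE [t == _]eq_sym (negbTE t't) andbF mul0r.
rewrite summxE big1// => t' _.
by rewrite tensmxE mxE [s == _]eq_sym (negbTE s's) mul0r.
Qed.

Lemma ppt_tens a b (A : 'M[C]_a) (B : 'M[C]_b) : psdmx A -> psdmx B ->
  psdmx (partial_transpose (A *t B)).
Proof.
by move=> A0 B0; rewrite partial_transpose_tens; apply/psdmx_tens/psdmx_tr.
Qed.

(** Fixing both input indices to s selects a principal submatrix of the partially transposed Choi
    matrix; since row and column inputs agree, transposing Bob's input has no effect on it. *)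
Lemma ppt_choi_delta a b a' b' (Pi : 'M[C]_(a * b) -> 'M[C]_(a' * b')) s :
  psdmx (partial_transpose (regroup (choi Pi))) ->
  psdmx (partial_transpose (Pi (delta_mx s s))).
Proof.
case: (mxtens_indexP s) => s1 s2.
pose f (u : 'I_(a' * b')) := mxtens_index
  (mxtens_index (s1, (mxtens_unindex u).1), mxtens_index (s2, (mxtens_unindex u).2)).
move=> /(psdmx_mxsub f); congr psdmx; apply/matrixP => u v.
case: (mxtens_indexP u) => u1 u2; case: (mxtens_indexP v) => v1 v2.
by rewrite mxE /f !mxtens_indexK !partial_transposeE regroupE choiE.
Qed.

Lemma separable_ppt a b (X : 'M[C]_(a * b)) :
  separable X -> psdmx (partial_transpose X).
Proof.
move=> [r [w [P [Q [w0 _ PQ ->]]]]].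
rewrite partial_transpose_sum; apply: psdmx_sum => x; have [P0 Q0] := PQ x.
by rewrite partial_transposeZ; apply: psdmxZ; rewrite ?ler0c//; exact: ppt_tens.
Qed.

(** A round sends a product of positive matrices to one such product per outcome, so the claim on
    product inputs passes through the induction on the protocol. *)
Lemma locc_ppt a' b' a b (Pi : 'M[C]_(a * b) -> 'M[C]_(a' * b')) : locc Pi ->
  forall A B, psdmx A -> psdmx B -> psdmx (partial_transpose (Pi (A *t B))).
Proof.
elim=> {a b Pi} [a b E F Pi [cpE _] [cpF _] PiE|a b r d E L Pi [cpE _] _ IH PiE|
  a b r d F L Pi [cpF _] _ IH PiE] A B A0 B0; rewrite PiE.
- rewrite tensmapE; [|by case: cpE|by case: cpF].
  by apply: ppt_tens; exact: cp_psdmx.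
- rewrite partial_transpose_sum; apply: psdmx_sum => x.
  rewrite tensmapE; [|by case: (cpE x)|exact: linear_idfun].
  by apply: IH => //; exact: cp_psdmx.
- rewrite partial_transpose_sum; apply: psdmx_sum => x.
  rewrite tensmapE; [|exact: linear_idfun|by case: (cpF x)].
  by apply: IH => //; exact: cp_psdmx.
Qed.

Lemma psdmx_delta n (i : 'I_n) : psdmx (delta_mx i i : 'M[C]_n).
Proof.
suff -> : delta_mx i i = proj_of (delta_mx i 0 : 'cV[C]_n) by exact: psdmx_proj_of.
apply/matrixP => k l; rewrite /proj_of !mxE big_ord1 !mxE eqxx !andbT.
by do 2 case: eqP; rewrite ?conjC0 ?conjC1 ?mulr0 ?mul0r ?mulr1.
Qed.

(** Beyond [cptp], this is what the converse uses of the four classes: a basis state of the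
    composite is a product, and its image has positive partial transpose. *)
Lemma in_class_ppt Omega a b a' b' (Pi : 'M[C]_(a * b) -> 'M[C]_(a' * b')) s :
  in_class Omega Pi -> psdmx (partial_transpose (Pi (delta_mx s s))).
Proof.
case=> _; case: Omega => [[r [E [F [[cpE _] cpF PiE]]]]|H|H|H].
- case: (mxtens_indexP s) => s1 s2.
  rewrite PiE delta_mx_tens partial_transpose_sum; apply: psdmx_sum => x.
  have [cpFx _] := cpF x.
  rewrite tensmapE; [|by case: (cpE x)|by case: cpFx].
  by apply: ppt_tens; apply: cp_psdmx => //; exact: psdmx_delta.
- case: (mxtens_indexP s) => s1 s2; rewrite delta_mx_tens.
  by apply: locc_ppt => //; exact: psdmx_delta.
- exact/ppt_choi_delta/separable_ppt.
- exact: ppt_choi_delta.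
Qed.

End LocalOperations.

(** * Bell-diagonal decomposition of the tensor power *)

Section Bits.

Definition bit (m i : nat) : bool := odd (i %/ 2 ^ m).

Lemma bit_top n (b : bool) j : (j < 2 ^ n)%N -> bit n (b * 2 ^ n + j) = b.
Proof. by move=> jn; rewrite /bit divnMDl ?expn_gt0// divn_small// addn0 oddb. Qed.

Lemma bit_low n m (c : nat) j : (m < n)%N -> bit m (c * 2 ^ n + j) = bit m j.
Proof.
move=> mn; rewrite /bit -(subnK (ltnW mn)) expnD mulnA divnMDl ?expn_gt0//.
by rewrite oddD oddM oddX subn_eq0 leqNgt mn/= andbF.
Qed.

(** 2^n - 1 - i is the bitwise complement of i, hence [rev_ord] pairs the indices on which the Bell
    vectors are supported. *)
Lemma bit_rev n m i : (m < n)%N -> (i < 2 ^ n)%N ->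
  bit m (2 ^ n - i.+1) = ~~ bit m i.
Proof.
elim: n i m => // n IH i m mn; rewrite expnS mul2n -addnn => i2.
have [b [j [jn iE]]] : exists b : bool, exists j, (j < 2 ^ n)%N /\ i = (b * 2 ^ n + j)%N.
  have [h|h] := ltnP i (2 ^ n); first by exists false, i.
  by exists true, (i - 2 ^ n)%N; rewrite mul1n subnKC// ltn_subLR.
have -> : (2 ^ n + 2 ^ n - i.+1 = (~~ b) * 2 ^ n + (2 ^ n - j.+1))%N.
  by rewrite iE; case: (b) => /=; lia.
have jn' : (2 ^ n - j.+1 < 2 ^ n)%N by lia.
move: mn; rewrite ltnS leq_eqVlt => /orP[/eqP->|mn].
  by rewrite iE !bit_top.
by rewrite iE !bit_low// IH.
Qed.

Lemma bit_inj n i j : (i < 2 ^ n)%N -> (j < 2 ^ n)%N ->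
  (forall m, (m < n)%N -> bit m i = bit m j) -> i = j.
Proof.
elim: n i j => [[] // []|n IH i j] //.
have dec k : (k < 2 ^ n.+1)%N ->
    exists b : bool, exists l, (l < 2 ^ n)%N /\ k = (b * 2 ^ n + l)%N.
  rewrite expnS mul2n -addnn => k2.
  have [h|h] := ltnP k (2 ^ n); first by exists false, k.
  by exists true, (k - 2 ^ n)%N; rewrite mul1n subnKC// ltn_subLR.
move=> /dec[b [i' [i'n ->]]] /dec[c [j' [j'n ->]]] h.
have := h n (ltnSn n); rewrite !bit_top// => ->; congr (_ + _)%N.
by apply: IH => // m mn; have := h m (ltnW mn); rewrite !bit_low.
Qed.

Lemma sum_prod_bit (V : comPzRingType) n (f : nat -> bool -> V) :
  \sum_(i < 2 ^ n) \prod_(m < n) f m (bit m i) =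
  \prod_(m < n) (f m false + f m true).
Proof.
elim: n => [|n IH]; first by rewrite big_ord1 !big_ord0.
rewrite -(big_mkord xpredT (fun i => \prod_(m < n.+1) f m (bit m i))).
rewrite (@big_cat_nat _ _ _ (2 ^ n))//= ?leq_exp2l//.
rewrite big_ord_recr/= -IH mulrDr !mulr_suml; congr (_ + _).
  rewrite big_mkord; apply: eq_bigr => i _; rewrite big_ord_recr/=.
  by rewrite -[X in bit n X]/(false * 2 ^ n + i)%N bit_top.
rewrite -{1}[(2 ^ n)%N]add0n big_addn expnS mul2n -addnn addnK big_mkord.
apply: eq_bigr => i _; rewrite big_ord_recr/= addnC.
rewrite -[X in (X + _)%N]mul1n (bit_top true)//; congr (_ * _).
by apply: eq_bigr => m _; rewrite bit_low.
Qed.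

End Bits.

Section BellDiagonal.
Variable R : realType.
Local Notation C := (complex R).
Local Notation rC := (@real_complex_def R (Phant R)).

Definition bit_ord (m i : nat) : 'I_2 := inord (bit m i).

(** [mxtens_index] is positional, so each new factor occupies the most significant bit of Alice's
    and of Bob's index. *)
Lemma bipower_recE (X : 'M[C]_(2 * 2)) n (i j k l : 'I_(2 ^ n.+1)) :
  bipower_rec X n (mxtens_index (i, j)) (mxtens_index (k, l)) =
  \prod_(m < n.+1) X (mxtens_index (bit_ord m i, bit_ord m j))
                     (mxtens_index (bit_ord m k, bit_ord m l)).
Proof.
elim: n i j k l => [|n IH] i j k l.
  rewrite big_ord1 /=.
  have bE (u : 'I_2) : bit_ord 0 u = u.
    by apply/val_inj; case: u => -[|[|//]] u2; rewrite /= inordK.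
  by rewrite !(bE (_ : 'I_2)).
have dec (u : 'I_(2 * 2 ^ n.+1)) : exists u0 u1, u = mxtens_index (u0, u1).
  by case: (mxtens_indexP u) => u0 u1; exists u0, u1.
have [i0 [i1 ->]] := dec i; have [j0 [j1 ->]] := dec j.
have [k0 [k1 ->]] := dec k; have [l0 [l1 ->]] := dec l.
rewrite big_ord_recr/= (@regroupE R 2 2) tensmxE IH mulrC.
have topE (u0 : 'I_2) (u1 : 'I_(2 ^ n.+1)) :
    bit_ord n.+1 (@mxtens_index 2 (2 ^ n.+1) (u0, u1)) = u0.
  apply/val_inj; rewrite /bit_ord /=.
  have -> : (u0 : nat) = (u0 == 1%N :> nat) by case: u0 => -[|[|]].
  by rewrite bit_top// inordK// ltnS leq_b1.
have lowE (m : 'I_n.+1) (u0 : 'I_2) (u1 : 'I_(2 ^ n.+1)) :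
    bit_ord m (@mxtens_index 2 (2 ^ n.+1) (u0, u1)) = bit_ord m u1.
  by rewrite /bit_ord /= bit_low.
congr (_ * _); last by rewrite !topE.
by apply: eq_bigr => m _; rewrite !lowE.
Qed.

Lemma proj_ofE d (v : 'cV[C]_d) s t : proj_of v s t = v s 0 * Num.conj (v t 0).
Proof. by rewrite /proj_of mxE big_ord1 !mxE. Qed.

(** Both Bell vectors live on the basis states with a != b; the second carries the extra sign
    (-1)^a. *)
Lemma rho_bellE (p : R) (a b c d : bool) :
  rho_bell p (mxtens_index (inord a, inord b)) (mxtens_index (inord c, inord d)) =
  rC (((a != b) && (c != d))%:R * (2^-1 * (p + (1 - p) * (-1) ^+ (a (+) c)))).
Proof.
have v1E (a' b' : bool) (z : 'I_1) : bell_v1 R (mxtens_index (inord a', inord b')) z =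
    rC ((Num.sqrt 2)^-1 * (a' != b')%:R).
  have -> : z = @mxtens_index 1 1 (0, 0) by rewrite [LHS]ord1 [RHS]ord1.
  rewrite mxE rmorphM/=; congr (_ * _).
  rewrite mxE !tensmxE /ket !mxE.
  by case: a'; case: b'; rewrite -!val_eqE /= !inordK//= ?(mul0r, mulr0, mul1r, addr0, add0r).
have v2E (a' b' : bool) (z : 'I_1) : bell_v2 R (mxtens_index (inord a', inord b')) z =
    rC ((Num.sqrt 2)^-1 * ((a' != b')%:R * (-1) ^+ a')).
  have -> : z = @mxtens_index 1 1 (0, 0) by rewrite [LHS]ord1 [RHS]ord1.
  rewrite mxE rmorphM/=; congr (_ * _).
  rewrite mxE [X in _ + X]mxE !tensmxE /ket !mxE.
  by case: a'; case: b'; rewrite -!val_eqE /= !inordK//= ?(mul0r, mulr0, mul1r,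
    mulr1, addr0, add0r, subr0, sub0r, oppr0, expr0, expr1, rmorphN1).
have s2 : (Num.sqrt 2)^-1 * (Num.sqrt 2)^-1 = 2^-1 :> R.
  by rewrite -invfM -expr2 sqr_sqrtr.
have cR (x : R) : Num.conj (rC x) = rC x by exact: conjc_real.
rewrite /rho_bell mxE [X in X + _]mxE [X in _ + X]mxE !proj_ofE !v1E !v2E !cR.
rewrite -!rmorphM -rmorphD.
congr rC.
have -> : (Num.sqrt 2)^-1 * (a != b)%:R * ((Num.sqrt 2)^-1 * (c != d)%:R) =
   2^-1 * ((a != b)%:R * (c != d)%:R) :> R by rewrite -s2; ring.
have -> : (Num.sqrt 2)^-1 * ((a != b)%:R * (-1) ^+ a) *
    ((Num.sqrt 2)^-1 * ((c != d)%:R * (-1) ^+ c)) =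
   2^-1 * ((a != b)%:R * (c != d)%:R * (-1) ^+ (a + c)) :> R.
  by rewrite exprD -s2; ring.
by rewrite signr_addb exprD -mulnb natrM; ring.
Qed.

End BellDiagonal.

(** * Phase errors and the characters of (Z/2)^n *)

Section PhaseErrors.
Variable R : realType.
Local Notation C := (complex R).
Local Notation rC := (@real_complex_def R (Phant R)).
Variable n : nat.
Local Notation G := {ffun 'I_n -> bool}.
Local Notation N := (2 ^ n)%N.

(** A true bit marks a pair in the state [bell_v2], which has probability 1 - p. *)
Definition weight (p : R) (x : G) : R := \prod_m (if x m then 1 - p else p).

(** The character (-1)^(x . i) of (Z/2)^n. *)
Definition chi (x : G) (i : nat) : R := \prod_m (-1) ^+ (x m && bit m i).

(* [N^(-1/2) \sum_i chi x i |i, ibar>], where [ibar], the bitwise complement of i,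
   is [rev_ord i]. *)
Definition psi (x : G) : 'cV[C]_(N * N) :=
  \col_s rC (((mxtens_unindex s).2 == rev_ord (mxtens_unindex s).1)%:R *
             (chi x (mxtens_unindex s).1 / Num.sqrt N%:R)).

Definition gadd (x y : G) : G := [ffun m => x m (+) y m].

Lemma chi_gadd x y i : chi (gadd x y) i = chi x i * chi y i.
Proof.
rewrite /chi -big_split; apply: eq_bigr => m _ /=.
by rewrite ffunE -signr_addb; case: (x m); case: (y m); case: bit.
Qed.

Lemma gaddC x y : gadd x y = gadd y x.
Proof. by apply/ffunP => m; rewrite !ffunE addbC. Qed.

Lemma gaddA x y z : gadd x (gadd y z) = gadd (gadd x y) z.
Proof. by apply/ffunP => m; rewrite !ffunE addbA. Qed.

Lemma gaddK x y : gadd x (gadd x y) = y.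
Proof. by apply/ffunP => m; rewrite !ffunE addbA addbb addFb. Qed.

Lemma gaddI x : injective (gadd x).
Proof. exact: can_inj (gaddK x). Qed.

Lemma sum_prod_bit_ord (V : comPzRingType) (f : 'I_n -> bool -> V) :
  \sum_(i < N) \prod_m f m (bit m i) = \prod_m (f m false + f m true).
Proof.
pose g m b := if insub m is Some m' then f m' b else 0.
have gE (m : 'I_n) b : g m b = f m b by rewrite /g valK.
transitivity (\sum_(i < N) \prod_(m < n) g m (bit m i)).
  by apply: eq_bigr => i _; apply: eq_bigr => m _; rewrite gE.
by rewrite sum_prod_bit; apply: eq_bigr => m _; rewrite !gE.
Qed.

Lemma chi_orthogonal x y :
  \sum_(i < N) chi x i * chi y i = (x == y)%:R * N%:R.
Proof.
under eq_bigr do rewrite -big_split/=.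
rewrite (sum_prod_bit_ord (fun m b => (-1) ^+ (x m && b) * (-1) ^+ (y m && b))).
have [->|xy] := eqVneq x y.
  rewrite mul1r natrX -[X in _ = _ ^+ X]card_ord -prodr_const.
  by apply: eq_bigr => m _; rewrite -!expr2 !sqrr_sign.
rewrite mul0r; apply/eqP/prodf_eq0.
have [m xym] : exists m, x m != y m.
  apply/existsP; apply: contra_neqT xy => /existsPn h; apply/ffunP => m.
  by apply/eqP/negPn.
exists m => //; rewrite !andbF !andbT expr0 mulr1.
by case: (x m) (y m) xym => -[]//= _; rewrite ?(expr0, expr1, mulr1, mul1r) subrr.
Qed.

Lemma prod_bit_neq (i j : 'I_N) :
  \prod_(m < n) (bit m i != bit m j)%:R = (j == rev_ord i)%:R :> R.
Proof.
have [->|ji] := eqVneq j (rev_ord i).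
  apply: big1 => m _; rewrite /= bit_rev//.
  by case: bit.
apply/eqP/prodf_eq0.
have [m h] : exists m : 'I_n, bit m i == bit m j.
  apply/existsP; apply: contra_neqT ji => /existsPn h; apply/val_inj.
  apply: (@bit_inj n); [exact: ltn_ord|exact: ltn_ord|] => m mn.
  rewrite /= bit_rev//.
  by have := h (Ordinal mn); case: (bit m i) (bit m j) => -[].
by exists m => //; rewrite h.
Qed.

(** Expanding the product selects one of the summands p and 1 - p for each pair; the selections are
    the phase errors x. *)
Lemma prod_phase (p : R) (i k : nat) :
  \prod_(m < n) (p + (1 - p) * (-1) ^+ (bit m i (+) bit m k)) =
  \sum_(x : G) weight p x * (chi x i * chi x k).
Proof.
transitivity (\prod_(m < n) \sum_(b : bool)
    (if b then 1 - p else p) * ((-1) ^+ (b && bit m i) * (-1) ^+ (b && bit m k))).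
  apply: eq_bigr => m _; rewrite big_bool/= signr_addb expr0 !mulr1.
  by rewrite addrC.
rewrite bigA_distr_bigA/=; apply: eq_bigr => x _.
by rewrite /weight /chi -!big_split.
Qed.

End PhaseErrors.

Lemma bipower_rho_bell (R : realType) (p : R) n :
  bipower (rho_bell p) n.+1 =
  \sum_(x : {ffun 'I_n.+1 -> bool})
    @real_complex_def R (Phant R) (weight p x) *: proj_of (psi R x).
Proof.
apply/matrixP => s t; case: (mxtens_indexP s) => i j.
case: (mxtens_indexP t) => k l.
rewrite /bipower bipower_recE summxE.
under eq_bigr do rewrite rho_bellE.
under [RHS]eq_bigr => x _.
  rewrite mxE proj_ofE !mxE !mxtens_indexK/= [Num.conj _]conjc_real -!rmorphM.
  over.
rewrite -rmorph_prod -rmorph_sum/=; congr (@real_complex_def R (Phant R)).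
have -> : \prod_(m < n.+1) (((bit m i != bit m j) && (bit m k != bit m l))%:R *
    (2^-1 * (p + (1 - p) * (-1) ^+ (bit m i (+) bit m k)))) =
  (j == rev_ord i)%:R * (l == rev_ord k)%:R *
  (((2 ^ n.+1)%:R)^-1 * \sum_(x : {ffun 'I_n.+1 -> bool}) weight p x * (chi R x i * chi R x k)).
  rewrite -!prod_bit_neq -prod_phase natrX -exprVn.
  have -> : 2^-1 ^+ n.+1 = \prod_(m < n.+1) 2^-1 :> R by rewrite prodr_const card_ord.
  rewrite -!big_split; apply: eq_bigr => m _ /=.
  by rewrite -mulnb natrM.
rewrite !mulr_sumr; apply: eq_bigr => x _.
have s0 : Num.sqrt (2 ^ n.+1)%:R != 0 :> R by rewrite sqrtr_eq0 -ltNge ltr0n expn_gt0.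
have -> : ((2 ^ n.+1)%:R)^-1 = (Num.sqrt (2 ^ n.+1)%:R)^-1 * (Num.sqrt (2 ^ n.+1)%:R)^-1 :> R.
  by rewrite -invfM -expr2 sqr_sqrtr.
ring.
Qed.

(** * Converse *)

Section Overlap.
Variable R : realType.
Local Notation C := (complex R).

Lemma mxtrace_mul_delta n (W : 'M[C]_n) s t : \tr (W *m delta_mx s t) = W t s.
Proof.
rewrite mxtrace_mulC /mxtrace (bigD1 s)//= [X in _ + X]big1 ?addr0 => [|u us].
  rewrite mxE (bigD1 t)//= [X in _ + X]big1 ?addr0 => [|v vt].
    by rewrite mxE !eqxx mul1r.
  by rewrite mxE (negbTE vt) andbF mul0r.
by rewrite mxE big1// => v _; rewrite mxE (negbTE us) mul0r.
Qed.

Lemma overlapE k (W : 'M[C]_(k * k)) : \tr (W *m max_entangled R k) =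
  k%:R^-1 * \sum_i \sum_j W (mxtens_index (j, j)) (mxtens_index (i, i)).
Proof.
rewrite /max_entangled -scalemxAr mxtraceZ; congr (_ * _).
rewrite mulmx_sumr raddf_sum; apply: eq_bigr => i _.
rewrite mulmx_sumr raddf_sum; apply: eq_bigr => j _.
exact: mxtrace_mul_delta.
Qed.

(** A single off-diagonal entry is complex and admits no comparison, whereas its sum with the
    transposed entry is real for a hermitian matrix. *)
Lemma ler_sum_sym (I : finType) (f g : I -> I -> C) :
  (forall i j, f i j + f j i <= g i j + g j i) ->
  \sum_i \sum_j f i j <= \sum_i \sum_j g i j.
Proof.
move=> fg; have dbl (h : I -> I -> C) :
    \sum_i \sum_j h i j + \sum_i \sum_j h i j = \sum_i \sum_j (h i j + h j i).
  rewrite {2}exchange_big -big_split; apply: eq_bigr => i _ /=.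
  by rewrite -big_split.
have : \sum_i \sum_j (f i j + f j i) <= \sum_i \sum_j (g i j + g j i).
  by apply: ler_sum => i _; apply: ler_sum.
rewrite -!dbl -!mulr2n => h.
by rewrite -(@ler_pMn2r _ 2).
Qed.

Lemma mxtrace_tens_index k l (W : 'M[C]_(k * l)) :
  \tr W = \sum_i \sum_j W (mxtens_index (i, j)) (mxtens_index (i, j)).
Proof. by rewrite /mxtrace sum_mxtens_index. Qed.

Lemma overlap_ge0 k (W : 'M[C]_(k * k)) : psdmx W ->
  0 <= \tr (W *m max_entangled R k).
Proof.
move=> W0; rewrite overlapE mulr_ge0 ?invr_ge0 ?ler0n//.
have W0t := psdmx_mxsub (fun i : 'I_k => mxtens_index (i, i)) W0.
have := W0t (const_mx 1); congr (is_true (0 <= _)); rewrite mxE.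
apply: eq_bigr => i _; rewrite [X in _ * X]mxE mulr1 mxE; apply: eq_bigr => j _.
by rewrite !mxE conjC1 mul1r.
Qed.

(** Off-diagonal entries are bounded by diagonal ones; each entry at |ii> is then counted k times,
    which cancels 1/k. *)
Lemma overlap_le_tr k (W : 'M[C]_(k * k)) : (0 < k)%N -> psdmx W ->
  \tr (W *m max_entangled R k) <= \tr W.
Proof.
move=> k0 W0; rewrite overlapE mulrC ler_pdivrMr ?ltr0n// mxtrace_tens_index.
pose w i := W (mxtens_index (i, i)) (mxtens_index (i, i)).
apply: (@le_trans _ _ (\sum_i \sum_(j < k) w i)).
  apply: (ler_sum_sym (f := fun i j => W (mxtens_index (j, j)) (mxtens_index (i, i)))
    (g := fun i j => w i)) => i j.
  by rewrite [leRHS]addrC; exact: psdmx_offdiag.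
rewrite mulr_suml; apply: ler_sum => i _; rewrite sumr_const card_ord -[leLHS]mulr_natr.
rewrite ler_wpM2r// (bigD1 i)//= lerDl sumr_ge0// => j _.
exact: psdmx_diag_ge0.
Qed.

(** Partial transposition moves the entry between |jj> and |ii> to the one between |ji> and |ij> and
    fixes the diagonal. Now each diagonal entry is counted once, so the factor 1/k survives. *)
Lemma overlap_ppt_le k (W : 'M[C]_(k * k)) : psdmx (partial_transpose W) ->
  \tr (W *m max_entangled R k) <= k%:R^-1 * \tr W.
Proof.
move=> W0; rewrite overlapE mxtrace_tens_index ler_wpM2l ?invr_ge0//.
apply: (ler_sum_sym (f := fun i j => W (mxtens_index (j, j)) (mxtens_index (i, i)))
  (g := fun i j => W (mxtens_index (i, j)) (mxtens_index (i, j)))) => i j.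
have := psdmx_offdiag (mxtens_index (j, i)) (mxtens_index (i, j)) W0.
by rewrite !partial_transposeE [leRHS]addrC.
Qed.

End Overlap.

(** * The upper bound on the fidelity *)

Section Converse.
Variable R : realType.
Local Notation C := (complex R).
Local Notation rC := (@real_complex_def R (Phant R)).

(** The case p = 1/2 of [prod_phase]: all weights are 2^-n, and a factor of the product vanishes
    wherever the bits of i and k differ. *)
Lemma sum_chi n (i k : 'I_(2 ^ n)) :
  \sum_(x : {ffun 'I_n -> bool}) chi R x i * chi R x k = (i == k)%:R * (2 ^ n)%:R.
Proof.
have <- : (2 ^ n)%:R * \sum_(x : {ffun 'I_n -> bool}) weight (2^-1 : R) x * (chi R x i * chi R x k) =
    \sum_(x : {ffun 'I_n -> bool}) chi R x i * chi R x k.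
  rewrite mulr_sumr; apply: eq_bigr => x _; rewrite mulrA.
  have -> : weight (2^-1 : R) x = 2^-1 ^+ n.
    transitivity (\prod_(m < n) (2^-1 : R)); last by rewrite prodr_const card_ord.
    apply: eq_bigr => m _.
    by case: (x m) => //; field.
  by rewrite natrX exprVn mulfV ?mul1r// expf_neq0.
rewrite -prod_phase mulrC; congr (_ * _).
have -> : (i == k)%:R = (k == rev_ord (rev_ord i))%:R :> R by rewrite rev_ordK eq_sym.
rewrite -prod_bit_neq; apply: eq_bigr => m _ /=; rewrite bit_rev//.
by case: bit; case: bit => /=; field.
Qed.

(** Summing over all phase errors cancels the coherences between different i, by [sum_chi], and
    leaves product basis states. *)
Lemma sum_proj_psi n : \sum_(x : {ffun 'I_n -> bool}) proj_of (psi R x) =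
  \sum_(i < 2 ^ n) delta_mx (mxtens_index (i, rev_ord i)) (mxtens_index (i, rev_ord i)).
Proof.
apply/matrixP => s t; case: (mxtens_indexP s) => i j.
case: (mxtens_indexP t) => k l; rewrite !summxE.
under eq_bigr => x _.
  rewrite proj_ofE !mxE !mxtens_indexK/= [Num.conj _]conjc_real -!rmorphM.
  over.
rewrite -rmorph_sum.
have s0 : Num.sqrt (2 ^ n)%:R != 0 :> R by rewrite sqrtr_eq0 -ltNge ltr0n expn_gt0.
have s2 : Num.sqrt (2 ^ n)%:R * Num.sqrt (2 ^ n)%:R = (2 ^ n)%:R :> R.
  by rewrite -expr2 sqr_sqrtr.
transitivity (rC ((j == rev_ord i)%:R * (l == rev_ord k)%:R * (i == k)%:R)).
  congr (real_complex_def _ _).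
  transitivity ((j == rev_ord i)%:R * (l == rev_ord k)%:R *
     ((Num.sqrt (2 ^ n)%:R)^-1 * (Num.sqrt (2 ^ n)%:R)^-1 *
      \sum_(x : {ffun 'I_n -> bool}) chi R x i * chi R x k) : R).
    by rewrite !mulr_sumr; apply: eq_bigr => x _; ring.
  by rewrite sum_chi; move: (Num.sqrt _) s0 s2 => r r0 <-; field.
rewrite (bigD1 i)//= [X in _ + X]big1 ?addr0 => [|u ui].
  rewrite mxE !(can_eq (@mxtens_indexK _ _)) !xpair_eqE eqxx/=.
  rewrite -!natrM !mulnb -!(rmorph_nat rC); congr (rC _%:R); congr nat_of_bool.
  have [->|ik] := eqVneq k i; first by rewrite ?eqxx ?andbT.
  by rewrite ?andbF.
by rewrite mxE !(can_eq (@mxtens_indexK _ _)) !xpair_eqE [i == u]eq_sym (negbTE ui).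
Qed.

Lemma tr_proj_psi n (x : {ffun 'I_n -> bool}) : \tr (proj_of (psi R x)) = 1.
Proof.
rewrite mxtrace_tens_index.
have s0 : Num.sqrt (2 ^ n)%:R != 0 :> R by rewrite sqrtr_eq0 -ltNge ltr0n expn_gt0.
transitivity (rC (\sum_(i < 2 ^ n) (chi R x i * chi R x i) / (2 ^ n)%:R)); last first.
  by rewrite -mulr_suml chi_orthogonal eqxx mul1r mulfV// pnatr_eq0 expn_eq0.
rewrite rmorph_sum; apply: eq_bigr => i _.
rewrite (bigD1 (rev_ord i))//= [X in _ + X]big1 ?addr0 => [|j ji].
  rewrite proj_ofE !mxE !mxtens_indexK/= [Num.conj _]conjc_real -!rmorphM/= eqxx.
  congr (real_complex_def _ _).
  have s2 : Num.sqrt (2 ^ n)%:R * Num.sqrt (2 ^ n)%:R = (2 ^ n)%:R :> R.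
    by rewrite -expr2 sqr_sqrtr.
  by rewrite (_ : true%:R = 1 :> R)//; move: (Num.sqrt _) s0 s2 => r r0 <-; field.
by rewrite proj_ofE !mxE !mxtens_indexK/= (negbTE ji) mul0r rmorph0 mul0r.
Qed.

Lemma weight_ge0 n p (x : {ffun 'I_n -> bool}) : 0 < p -> p < 1 -> 0 <= weight p x :> R.
Proof.
by move=> p0 p1; apply: prodr_ge0 => m _; case: (x m); rewrite ?subr_ge0 ltW.
Qed.

Lemma fidelity_le Omega (p t : R) n k
    (Pi : 'M[C]_(2 ^ n.+1 * 2 ^ n.+1) -> 'M[C]_(k * k)) :
  0 < p -> p < 1 -> 0 <= t -> (0 < k)%N -> in_class Omega Pi ->
  complex.Re (\tr (Pi (bipower (rho_bell p) n.+1) *m max_entangled R k)) <=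
  \sum_(x : {ffun 'I_n.+1 -> bool} | t < weight p x) weight p x +
    t * (2 ^ n.+1)%:R / k%:R.
Proof.
move=> p0 p1 t0 k0 PiO; have [[cpPi trPi] _] := PiO; have [linPi _] := cpPi.
pose M (x : {ffun 'I_n.+1 -> bool}) := \tr (Pi (proj_of (psi R x)) *m max_entangled R k).
pose m x := complex.Re (M x).
have MP x : psdmx (Pi (proj_of (psi R x))) by apply/(cp_psdmx cpPi)/psdmx_proj_of.
have M0 x : 0 <= M x by exact: overlap_ge0.
have Mm x : M x = rC (m x) by rewrite RRe_real// ger0_real.
have m0 x : 0 <= m x by rewrite -ler0c -Mm.
have m1 x : m x <= 1.
  rewrite -lecR -Mm (le_trans (overlap_le_tr k0 (MP x)))//.
  by rewrite trPi tr_proj_psi.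
have sm : \sum_x m x <= (2 ^ n.+1)%:R / k%:R.
  rewrite -lecR rmorph_sum/=; under eq_bigr do rewrite -Mm.
  have linS (I : finType) (X : I -> 'M[C]_(2 ^ n.+1 * 2 ^ n.+1)) :
      Pi (\sum_i X i) = \sum_i Pi (X i).
    have := linear_sumZ linPi (fun=> 1) X.
    by under eq_bigr do rewrite scale1r; under [X in _ = X]eq_bigr do rewrite scale1r.
  rewrite /M -raddf_sum -mulmx_suml -linS sum_proj_psi linS mulmx_suml raddf_sum.
  apply: (@le_trans _ _ (\sum_(i < 2 ^ n.+1) k%:R^-1)).
    apply: ler_sum => i _.
    apply: (le_trans (overlap_ppt_le (in_class_ppt _ PiO))).
    rewrite trPi -[delta_mx _ _]mul1mx mxtrace_mul_delta mxE eqxx mulr1.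
    exact: lexx.
  by rewrite sumr_const card_ord -[leLHS]mulr_natl rmorphM fmorphV !rmorph_nat lexx.
have -> : \tr (Pi (bipower (rho_bell p) n.+1) *m max_entangled R k) =
    rC (\sum_x weight p x * m x).
  rewrite bipower_rho_bell (linear_sumZ linPi) mulmx_suml [LHS]raddf_sum.
  rewrite rmorph_sum; apply: eq_bigr => x _.
  by rewrite -scalemxAl /= mxtraceZ -/(M _) Mm rmorphM.
(* Errors of weight above t use [m1]; the others use weight at most t and the bound [sm] on the
   total overlap. *)
rewrite /= (bigID (fun x => t < weight p x))/= lerD//.
  by apply: ler_sum => x _; rewrite ler_piMr// weight_ge0.
apply: (@le_trans _ _ (\sum_x t * m x)).
  rewrite [leRHS](bigID (fun x => t < weight p x))/= ler_wpDl//.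
    by apply: sumr_ge0 => x _; rewrite mulr_ge0.
  by apply: ler_sum => x; rewrite -leNgt => xt; rewrite ler_wpM2r.
by rewrite -mulr_sumr -mulrA ler_wpM2l.
Qed.

End Converse.

(** * Achievability *)

Section Kraus.
Variable R : realType.
Local Notation C := (complex R).

Definition kraus (I : finType) m n (K : I -> 'M[C]_(m, n)) (X : 'M[C]_n) : 'M[C]_m :=
  \sum_i K i *m X *m adjmx (K i).

Lemma kraus_linear (I : finType) m n (K : I -> 'M[C]_(m, n)) : linear (kraus K).
Proof.
move=> a X Y; rewrite /kraus scaler_sumr -big_split; apply: eq_bigr => i _ /=.
by rewrite mulmxDr mulmxDl -scalemxAr -scalemxAl.
Qed.

Lemma kraus_idE n (X : 'M[C]_n) : kraus (fun _ : unit => 1%:M) X = X.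
Proof.
rewrite /kraus big_const card_unit /= addr0 mul1mx /adjmx trmx1 map_mx1.
by rewrite mulmx1.
Qed.

Lemma eq_tensmap a b a' b' (E E' : 'M[C]_a -> 'M[C]_a') (F F' : 'M[C]_b -> 'M[C]_b') :
  E =1 E' -> F =1 F' -> tensmap E F =1 tensmap E' F'.
Proof.
move=> EE FF X; apply: eq_bigr => s _; apply: eq_bigr => t _.
by rewrite EE FF.
Qed.

Lemma tensmap_kraus (I J : finType) a b a' b' (A : I -> 'M[C]_(a', a))
    (B : J -> 'M[C]_(b', b)) X :
  tensmap (kraus A) (kraus B) X = kraus (fun ij : I * J => A ij.1 *t B ij.2) X.
Proof.
rewrite [in RHS](matrix_sum_deltaZ X) (linear_sumZ (kraus_linear _)).
rewrite -(pair_bigA _ (fun s t => X s t *: kraus _ (delta_mx s t))).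
apply: eq_bigr => s _; apply: eq_bigr => t _; congr (_ *: _).
case: (mxtens_indexP s) => s1 s2; case: (mxtens_indexP t) => t1 t2.
rewrite !mxtens_indexK/= delta_mx_tens /kraus tensmx_suml.
rewrite -(pair_bigA _ (fun i j => (A i *t B j) *m _ *m adjmx (A i *t B j))).
apply: eq_bigr => i _; rewrite tensmx_sumr; apply: eq_bigr => j _ /=.
by rewrite adjmx_tens !tensmx_mul.
Qed.

Lemma kraus_psdmx (I : finType) m n (K : I -> 'M[C]_(m, n)) X :
  psdmx X -> psdmx (kraus K X).
Proof. by move=> X0; apply: psdmx_sum => i; exact: psdmx_conj. Qed.

(** The identity channel is a Kraus map, so its tensor product with [kraus K] is again one. *)
Lemma kraus_cp (I : finType) m n (K : I -> 'M[C]_(m, n)) : cp (kraus K).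
Proof.
split; first exact: kraus_linear.
move=> k X X0; rewrite (eq_tensmap (fun Y => esym (kraus_idE Y)) (frefl _)).
by rewrite tensmap_kraus; exact: kraus_psdmx.
Qed.

Lemma kraus_tr (I : finType) m n (K : I -> 'M[C]_(m, n)) X :
  \tr (kraus K X) = \tr ((\sum_i adjmx (K i) *m K i) *m X).
Proof.
rewrite mulmx_suml !raddf_sum; apply: eq_bigr => i _ /=.
by rewrite mxtrace_mulC mulmxA.
Qed.

Lemma kraus_cptp (I : finType) m n (K : I -> 'M[C]_(m, n)) :
  \sum_i adjmx (K i) *m K i = 1%:M -> cptp (kraus K).
Proof. by move=> K1; split=> [|X]; [exact: kraus_cp|rewrite kraus_tr K1 mul1mx]. Qed.

Lemma eq_cptp m n (E F : 'M[C]_m -> 'M[C]_n) : E =1 F -> cptp E -> cptp F.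
Proof. by move=> /funext ->. Qed.

Lemma cptp_idfun n : cptp (@idfun 'M[C]_n).
Proof.
apply: (eq_cptp (@kraus_idE n)); apply: kraus_cptp.
by rewrite big_const card_unit /= addr0 mulmx1 /adjmx trmx1 map_mx1.
Qed.

Lemma tensmap_linear a b a' b' (E : 'M[C]_a -> 'M[C]_a') (F : 'M[C]_b -> 'M[C]_b') :
  linear (tensmap E F).
Proof.
move=> c X Y; rewrite /tensmap scaler_sumr -big_split; apply: eq_bigr => s _ /=.
rewrite scaler_sumr -big_split; apply: eq_bigr => t _ /=.
by rewrite !mxE scalerDl scalerA.
Qed.

Lemma tensmap_idfun_comp a b a' b' (E : 'M[C]_a -> 'M[C]_a') (F : 'M[C]_b -> 'M[C]_b') X :
  linear E -> linear F ->
  tensmap (@idfun 'M[C]_a') F (tensmap E (@idfun 'M[C]_b) X) = tensmap E F X.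
Proof.
move=> linE linF.
rewrite (matrix_sum_deltaZ X) !(linear_sumZ (tensmap_linear _ _)).
apply: eq_bigr => -[s t] _; congr (_ *: _) => /=.
case: (mxtens_indexP s) => s1 s2; case: (mxtens_indexP t) => t1 t2.
rewrite delta_mx_tens (tensmapE _ _ linE (@linear_idfun _ _)).
by rewrite !tensmapE.
Qed.

(** The Choi matrix is the image under id tensor E of the projector on the unnormalised maximally
    entangled vector [w]. *)
Lemma cp_choi_psdmx m n (E : 'M[C]_m -> 'M[C]_n) : cp E -> psdmx (choi E).
Proof.
move=> [linE cpE].
pose w : 'cV[C]_(m * m) := \col_s ((mxtens_unindex s).1 == (mxtens_unindex s).2)%:R.
have -> : choi E = tensmap (@idfun 'M[C]_m) E (proj_of w); last exact/cpE/psdmx_proj_of.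
have -> : proj_of w =
    \sum_(st : 'I_m * 'I_m) 1 *: (delta_mx st.1 st.2 *t delta_mx st.1 st.2).
  apply/matrixP => s t; case: (mxtens_indexP s) => i x; case: (mxtens_indexP t) => j y.
  rewrite proj_ofE !mxE !mxtens_indexK/= summxE.
  transitivity ((delta_mx x y : 'M[C]_m) i j).
    by rewrite mxE conjC_nat -natrM mulnb.
  rewrite [delta_mx x y](matrix_sum_deltaZ _) summxE; apply: eq_bigr => -[k l] _.
  by rewrite scale1r tensmxE !mxE/= [x == k]eq_sym [y == l]eq_sym mulrC.
rewrite (linear_sumZ (tensmap_linear _ _)) /choi pair_bigA; apply: eq_bigr => -[s t] _.
by rewrite scale1r (tensmapE _ _ (@linear_idfun _ _) linE).
Qed.

Lemma regroup_choi_tensmap a b a' b' (E : 'M[C]_a -> 'M[C]_a') (F : 'M[C]_b -> 'M[C]_b') :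
  linear E -> linear F -> regroup (choi (tensmap E F)) = choi E *t choi F.
Proof.
move=> linE linF; apply/matrixP => s t.
case: (mxtens_indexP s) => u v; case: (mxtens_indexP t) => w z.
case: (mxtens_indexP u) => u1 u2; case: (mxtens_indexP v) => v1 v2.
case: (mxtens_indexP w) => w1 w2; case: (mxtens_indexP z) => z1 z2.
by rewrite regroupE choiE delta_mx_tens tensmapE// !tensmxE !choiE.
Qed.

(** Uniform weights 1/r are compensated by scaling the P x by r. An empty sum has no weights adding
    up to 1 and is written as one zero term. *)
Lemma separable_sum_tens a b r (P : 'I_r -> 'M[C]_a) (Q : 'I_r -> 'M[C]_b) :
  (forall x, psdmx (P x)) -> (forall x, psdmx (Q x)) ->
  separable (\sum_x P x *t Q x).
Proof.
case: r P Q => [|r] P Q P0 Q0.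
  exists 1%N, (fun=> 1), (fun=> 0), (fun=> 0); split=> //.
  - by rewrite big_ord1.
  - by move=> _; split; exact: psdmx0.
  - by rewrite big_ord0 big_ord1 tens0mx scaler0.
exists r.+1, (fun=> r.+1%:R^-1), (fun x => r.+1%:R *: P x), Q; split=> [x||x|].
- by rewrite invr_ge0.
- by rewrite sumr_const card_ord -[LHS]mulr_natl mulfV.
- by split=> //; apply: psdmxZ => //; rewrite ler0n.
- apply: eq_bigr => x _; rewrite tensmxZl scalerA fmorphV rmorph_nat mulVf ?scale1r//.
Qed.

Lemma regroup_sum a b a' b' (I : finType) (X : I -> 'M[C]_((a * b) * (a' * b'))) :
  regroup (\sum_i X i) = \sum_i regroup (X i).
Proof.
apply/matrixP => s t; rewrite mxE !summxE.
by apply: eq_bigr => i _; rewrite mxE.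
Qed.

Lemma choi_sum m n (I : finType) (E : I -> 'M[C]_m -> 'M[C]_n) :
  choi (fun X => \sum_i E i X) = \sum_i choi (E i).
Proof.
apply/matrixP => s t.
case: (mxtens_indexP s) => i x; case: (mxtens_indexP t) => j y.
by rewrite choiE [RHS]summxE [LHS]summxE; apply: eq_bigr => k _; rewrite choiE.
Qed.

(** One protocol thus serves all four classes. As [locc] it is one round of Alice followed by local
    channels; its Choi matrix is a sum of products of local Choi matrices, hence separable and
    PPT. *)
Lemma one_way_locc_in_class Omega a b a' b' (Pi : 'M[C]_(a * b) -> 'M[C]_(a' * b')) :
  cptp Pi -> one_way_locc Pi -> in_class Omega Pi.
Proof.
move=> PiC PiO; split=> //; case: (PiO) => r [E [F [[cpE trE] cpF PiE]]].
have linE x : linear (E x) by case: (cpE x).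
have linF x : linear (F x) by case: (cpF x) => -[].
have sepPi : separable (regroup (choi Pi)).
  have -> : Pi = fun X => \sum_x tensmap (E x) (F x) X by exact/funext.
  rewrite choi_sum regroup_sum.
  under eq_bigr do rewrite regroup_choi_tensmap//.
  apply: separable_sum_tens => x; apply: cp_choi_psdmx => //.
  by case: (cpF x).
case: Omega => //; last exact: separable_ppt.
apply: (@locc_alice _ _ _ _ _ r (fun=> a') E (fun x => tensmap idfun (F x))) => //.
- move=> x; apply: (@locc_local _ _ _ _ _ idfun (F x)) => //.
  exact: cptp_idfun.
- by move=> X; rewrite PiE; apply: eq_bigr => x _; rewrite tensmap_idfun_comp.
Qed.

End Kraus.

(** * The one-way distillation protocol *)

Section Protocol.
Variable R : realType.
Local Notation C := (complex R).
Local Notation rC := (@real_complex_def R (Phant R)).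
Variables (n k : nat).
Local Notation G := {ffun 'I_n -> bool}.
Local Notation N := (2 ^ n)%N.
Variables (c : 'I_k -> G) (dec : G -> 'I_k).

Definition alice_kraus (t : G) : 'M[C]_(k, N) :=
  \matrix_(j, i) rC (chi R (gadd (c j) t) i / Num.sqrt (k * N)%:R).

(* b is the phase error and j the codeword found by the decoder; the pair
   determines the word b + c_j, hence completeness whatever dec is. *)
Definition bob_kraus (t b : G) : 'M[C]_(k, N) :=
  \matrix_(j, i) rC ((dec (gadd b (c j)) == j)%:R *
    (chi R (gadd (gadd b (c j)) t) (rev_ord i) / Num.sqrt N%:R)).

Let N0 : N%:R != 0 :> R. Proof. by rewrite pnatr_eq0 expn_eq0. Qed.

Let s20 : Num.sqrt N%:R != 0 :> R.
Proof. by rewrite sqrtr_eq0 -ltNge ltr0n expn_gt0. Qed.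

Let s22 : Num.sqrt N%:R * Num.sqrt N%:R = N%:R :> R.
Proof. by rewrite -expr2 sqr_sqrtr. Qed.

Lemma adjmx_mul_selfE (I : finType) m l (K : I -> 'M[C]_(m, l)) (r : I -> 'I_m -> 'I_l -> R) :
  (forall a i j, K a i j = rC (r a i j)) -> forall i j,
  (\sum_a adjmx (K a) *m K a) i j = rC (\sum_a \sum_u r a u i * r a u j).
Proof.
move=> KE i j; rewrite summxE rmorph_sum; apply: eq_bigr => a _.
rewrite mxE rmorph_sum; apply: eq_bigr => u _.
by rewrite !mxE !KE [Num.conj _]conjc_real rmorphM.
Qed.

Lemma alice_complete : (0 < k)%N -> \sum_t adjmx (alice_kraus t) *m alice_kraus t = 1%:M.
Proof.
move=> k0; apply/matrixP => i j.
rewrite (adjmx_mul_selfE (r := fun t u i => chi R (gadd (c u) t) i / Num.sqrt (k * N)%:R));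
  last by move=> *; rewrite mxE.
have kN0 : (k * N)%:R != 0 :> R by rewrite pnatr_eq0 muln_eq0 negb_or expn_eq0 -lt0n k0.
have s2 : Num.sqrt (k * N)%:R * Num.sqrt (k * N)%:R = (k * N)%:R :> R.
  by rewrite -expr2 sqr_sqrtr.
have s0 : Num.sqrt (k * N)%:R != 0 :> R.
  by apply: contra_neq kN0 => s0; rewrite -s2 s0 mul0r.
rewrite exchange_big/=.
transitivity (rC (\sum_(u < k) (i == j)%:R / k%:R)).
  congr (real_complex_def _ _); apply: eq_bigr => u _.
  transitivity (\sum_(t : G) chi R t i / Num.sqrt (k * N)%:R * (chi R t j / Num.sqrt (k * N)%:R)).
    by rewrite [RHS](reindex_inj (@gaddI n (c u))).
  transitivity ((\sum_(t : G) chi R t i * chi R t j) / (k * N)%:R).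
    rewrite mulr_suml; apply: eq_bigr => t _.
    by move: (Num.sqrt _) s0 s2 => r r0 <-; field.
  rewrite sum_chi natrM; have : k%:R != 0 :> R by rewrite pnatr_eq0 -lt0n.
  by move=> k00; field; rewrite k00.
rewrite sumr_const card_ord -[_ / _ *+ k]mulr_natr divfK ?pnatr_eq0 -?lt0n//.
by rewrite rmorph_nat mxE.
Qed.

(** After the substitution y = b + c_u, each word y survives for exactly one u, namely [dec y], and
    [sum_chi] applies. *)
Lemma bob_complete t : \sum_b adjmx (bob_kraus t b) *m bob_kraus t b = 1%:M.
Proof.
apply/matrixP => i j.
rewrite (adjmx_mul_selfE (r := fun b u i => (dec (gadd b (c u)) == u)%:R *
    (chi R (gadd (gadd b (c u)) t) (rev_ord i) / Num.sqrt N%:R)));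
  last by move=> *; rewrite mxE.
pose h y := chi R (gadd y t) (rev_ord i) / Num.sqrt N%:R *
  (chi R (gadd y t) (rev_ord j) / Num.sqrt N%:R).
transitivity (rC (\sum_y h y)).
  congr (real_complex_def _ _); rewrite exchange_big/=.
  transitivity (\sum_(u < k) \sum_y (dec y == u)%:R * h y).
    apply: eq_bigr => u _.
    rewrite [RHS](reindex_inj (@gaddI n (c u))); apply: eq_bigr => b _.
    rewrite /= [gadd (c u) b]gaddC /h.
    have t1 : true%:R = 1 :> R by [].
    have f0 : false%:R = 0 :> R by [].
    by case: (_ == _); rewrite ?t1 ?f0; ring.
  rewrite exchange_big; apply: eq_bigr => y _ /=.
  rewrite -mulr_suml (bigD1 (dec y))//= eqxx big1 ?addr0 ?mul1r// => u uy.
  by rewrite eq_sym (negbTE uy).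
transitivity (rC ((\sum_(y : G) chi R y (rev_ord i) * chi R y (rev_ord j)) / N%:R)).
  congr (real_complex_def _ _).
  rewrite [in RHS](reindex_inj (@gaddI n t)) mulr_suml; apply: eq_bigr => y _.
  rewrite /h [gadd y t]gaddC.
  by move: (Num.sqrt _) s20 s22 => r r0 <-; field.
by rewrite sum_chi (inj_eq rev_ord_inj) mulfK// rmorph_nat mxE.
Qed.

(** The characters of c_j + t and b + c_j + t multiply to that of b, so t and c_j drop out and
    orthogonality forces b = x. The surviving |jj> all have the same amplitude and add coherently,
    whence the square. *)
Lemma protocol_overlap (t b x : G) : (0 < k)%N ->
  \tr (((alice_kraus t *t bob_kraus t b) *m proj_of (psi R x) *m
        adjmx (alice_kraus t *t bob_kraus t b)) *m max_entangled R k) =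
  rC ((b == x)%:R * ((\sum_(j < k) (dec (gadd x (c j)) == j)%:R) / k%:R) ^+ 2 / N%:R).
Proof.
move=> k0; set K := alice_kraus t *t bob_kraus t b.
have -> : K *m proj_of (psi R x) *m adjmx K = proj_of (K *m psi R x).
  by rewrite /proj_of adjmxM !mulmxA.
have kN0 : (k * N)%:R != 0 :> R by rewrite pnatr_eq0 muln_eq0 negb_or expn_eq0 -lt0n k0.
have s2 : Num.sqrt (k * N)%:R * Num.sqrt (k * N)%:R = (k * N)%:R :> R.
  by rewrite -expr2 sqr_sqrtr.
have s0 : Num.sqrt (k * N)%:R != 0 :> R.
  by apply: contra_neq kN0 => s0; rewrite -s2 s0 mul0r.
have uE j : (K *m psi R x) (mxtens_index (j, j)) 0 =
    rC ((b == x)%:R * (dec (gadd x (c j)) == j)%:R / Num.sqrt (k * N)%:R).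
  rewrite mxE sum_mxtens_index.
  transitivity (\sum_(i < N) rC (chi R (gadd (c j) t) i / Num.sqrt (k * N)%:R *
     ((dec (gadd b (c j)) == j)%:R *
      (chi R (gadd (gadd b (c j)) t) i / Num.sqrt N%:R)) *
      (chi R x i / Num.sqrt N%:R))).
    apply: eq_bigr => i _; rewrite (bigD1 (rev_ord i))//= [X in _ + X]big1 ?addr0.
      rewrite tensmxE !mxE !mxtens_indexK rev_ordK/= eqxx -!rmorphM/=.
      by rewrite (_ : true%:R = 1 :> R)// mul1r.
    move=> l li; rewrite tensmxE [psi R x _ _]mxE mxtens_indexK/= (negbTE li).
    by rewrite mul0r rmorph0 mulr0.
  rewrite -rmorph_sum; congr (real_complex_def _ _).
  transitivity ((dec (gadd b (c j)) == j)%:R / Num.sqrt (k * N)%:R / N%:R *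
      \sum_(i < N) chi R b i * chi R x i : R).
    rewrite mulr_sumr; apply: eq_bigr => i _.
    have E : chi R (gadd (c j) t) i * chi R (gadd (gadd b (c j)) t) i = chi R b i.
      by rewrite -chi_gadd -[gadd (gadd b _) t]gaddA [gadd b _]gaddC gaddK.
    rewrite -E; move: (Num.sqrt N%:R) s20 s22 => r r0 <-; field.
    by rewrite r0 s0.
  rewrite chi_orthogonal; case: (eqVneq b x) => [->|_]; last by rewrite !mul0r mulr0.
  by field; rewrite s0 N0.
rewrite overlapE.
under eq_bigr => i _ do
  under eq_bigr => j _ do rewrite proj_ofE !uE [Num.conj _]conjc_real -rmorphM.
transitivity (rC (k%:R^-1 * \sum_(i < k) \sum_(j < k)
   ((b == x)%:R * (dec (gadd x (c j)) == j)%:R / Num.sqrt (k * N)%:R *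
    ((b == x)%:R * (dec (gadd x (c i)) == i)%:R / Num.sqrt (k * N)%:R)))).
  rewrite [RHS]rmorphM; congr (_ * _); first by rewrite fmorphV rmorph_nat.
  rewrite [RHS]rmorph_sum; apply: eq_bigr => i _.
  by rewrite [RHS]rmorph_sum.
congr (real_complex_def _ _).
have k00 : k%:R != 0 :> R by rewrite pnatr_eq0 -lt0n.
pose g : R := \sum_(j < k) (dec (gadd x (c j)) == j)%:R; rewrite -/g.
transitivity (k%:R^-1 * (((b == x)%:R * (b == x)%:R / (k * N)%:R) * (g * g))).
  congr (_ * _); rewrite /g mulr_suml mulr_sumr; apply: eq_bigr => i _.
  rewrite mulr_sumr mulr_sumr; apply: eq_bigr => j _.
  by move: (Num.sqrt _) s0 s2 => r r0 <-; field.
rewrite -natrM mulnb andbb natrM; field.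
by rewrite k00 N0.
Qed.

End Protocol.

Lemma protocol_fidelity (R : realType) Omega (p : R) n k
    (c : 'I_k -> {ffun 'I_n.+1 -> bool}) (dec : {ffun 'I_n.+1 -> bool} -> 'I_k) :
  (0 < k)%N ->
  exists Pi : 'M[complex R]_(2 ^ n.+1 * 2 ^ n.+1) -> 'M[complex R]_(k * k),
    in_class Omega Pi /\
    complex.Re (\tr (Pi (bipower (rho_bell p) n.+1) *m max_entangled R k)) =
    \sum_x weight p x * ((\sum_(j < k) (dec (gadd x (c j)) == j)%:R) / k%:R) ^+ 2.
Proof.
move=> k0; pose G : finType := {ffun 'I_n.+1 -> bool}.
pose A := @alice_kraus R _ k c; pose B := @bob_kraus R _ k c dec.
pose K (tb : G * G) := A tb.1 *t B tb.1 tb.2.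
exists (kraus K); split.
  apply: one_way_locc_in_class.
    apply: kraus_cptp; rewrite /K.
    rewrite -(pair_bigA _ (fun t b => adjmx (A t *t B t b) *m (A t *t B t b)))/=.
    under eq_bigr => t _.
      under eq_bigr do rewrite adjmx_tens tensmx_mul.
      rewrite -tensmx_sumr bob_complete.
      over.
    rewrite -tensmx_suml alice_complete//.
    apply/matrixP => s t; case: (mxtens_indexP s) => i j; case: (mxtens_indexP t) => u v.
    by rewrite tensmxE !mxE (can_eq (@mxtens_indexK _ _)) xpair_eqE -natrM mulnb.
  exists #|{: G}|, (fun a => kraus (fun _ : unit => A (enum_val a))),
    (fun a => kraus (B (enum_val a))); split.
  - split=> [a|X]; first exact: kraus_cp.
    transitivity (\sum_t \tr (kraus (fun _ : unit => A t) X)).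
      by rewrite [RHS](reindex _ (onW_bij _ (@enum_val_bij G))).
    under eq_bigr do rewrite kraus_tr big_const card_unit /= addr0.
    rewrite -[LHS](raddf_sum (mxtrace : {additive _ -> _})) -mulmx_suml.
    by rewrite alice_complete// mul1mx.
  - by move=> a; apply: kraus_cptp; exact: bob_complete.
  - move=> X; transitivity
      (\sum_t tensmap (kraus (fun _ : unit => A t)) (kraus (B t)) X); last first.
      by rewrite [LHS](reindex _ (onW_bij _ (@enum_val_bij G))).
    rewrite /kraus -(pair_bigA _ (fun t b => K (t, b) *m X *m adjmx (K (t, b)))).
    apply: eq_bigr => t _; rewrite tensmap_kraus /kraus.
    rewrite -(pair_bigA _ (fun (_ : unit) b => K (t, b) *m X *m adjmx (K (t, b)))).
    by rewrite big_const card_unit /= addr0.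
pose F (x : G) : R :=
  weight p x * ((\sum_(j < k) (dec (gadd x (c j)) == j)%:R) / k%:R) ^+ 2.
have -> : \tr (kraus K (bipower (rho_bell p) n.+1) *m max_entangled R k) =
    @real_complex_def R (Phant R) (\sum_x F x); last by [].
rewrite bipower_rho_bell (linear_sumZ (kraus_linear _)) mulmx_suml [LHS]raddf_sum.
rewrite rmorph_sum; apply: eq_bigr => x _.
rewrite -scalemxAl /= mxtraceZ /F rmorphM; congr (_ * _).
rewrite /kraus mulmx_suml raddf_sum.
rewrite -(pair_bigA _ (fun t b => \tr (K (t, b) *m proj_of (psi R x) *m adjmx (K (t, b)) *m max_entangled R k))).
under eq_bigr => t _ do under eq_bigr => b _ do rewrite protocol_overlap//.
under eq_bigr => t _.
  rewrite (bigD1 x)//= eqxx [X in _ + X]big1 ?addr0 => [|b bx].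
    over.
  by rewrite (negbTE bx) !mul0r.
(* The 2^(n+1) messages t contribute equally, which cancels the last factor in
   [protocol_overlap]. *)
rewrite sumr_const card_ffun card_bool card_ord -[LHS]mulr_natl -[_%:R](rmorph_nat
  (@real_complex_def R (Phant R))) -rmorphM; congr (real_complex_def _ _).
by rewrite (_ : true%:R = 1 :> R)// mul1r mulrC divfK// pnatr_eq0 expn_eq0.
Qed.

(** * Greedy codes for a prescribed set of errors *)

Section Coding.
Variables (R : realType) (n : nat).
Local Notation G := {ffun 'I_n -> bool}.
Local Notation N := (2 ^ n)%N.

Lemma card_phase : #|{: G}| = N.
Proof. by rewrite card_ffun card_bool card_ord. Qed.

Lemma exists_le_average (h : G -> R) (a : R) :
  \sum_x h x <= N%:R * a -> exists x, h x <= a.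
Proof.
move=> ha; apply: contrapT => /forallNP H.
have : \sum_(x : G) a < \sum_x h x.
  apply: ltr_sum => [|x _]; last by rewrite ltNge; exact/negP/H.
  by apply/hasP; exists [ffun=> false].
by rewrite sumr_const card_phase -[_ *+ _]mulr_natl ltNge ha.
Qed.

(* Every new codeword is chosen with a total collision weight against the
   previous ones that is at most its average. *)
Lemma greedy_code (K : G -> R) (a : R) : \sum_x K x <= N%:R * a ->
  forall k, exists c : nat -> G,
    \sum_(j < k) \sum_(l < j) K (gadd (c j) (c l)) <= \sum_(j < k) j%:R * a.
Proof.
move=> Ka; elim=> [|k [c cP]]; first by exists (fun=> [ffun=> false]); rewrite !big_ord0.
have [y yP] : exists y, \sum_(l < k) K (gadd y (c l)) <= k%:R * a.
  apply: exists_le_average; rewrite exchange_big/= mulrCA -[k in k%:R]card_ord.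
  rewrite mulr_natl -sumr_const; apply: ler_sum => l _.
  rewrite (le_trans _ Ka)// [leRHS](reindex_inj (@gaddI n (c l))).
  by apply/ler_sum => x _; rewrite gaddC.
exists (fun j => if (j < k)%N then c j else y).
rewrite !big_ord_recr/= ltnn lerD//.
  apply: le_trans cP; apply: ler_sum => j _; apply: ler_sum => l _.
  by rewrite ltn_ord (ltn_trans _ (ltn_ord j)).
by apply: le_trans yP; apply: ler_sum => l _; rewrite ltn_ord.
Qed.

Lemma sum_sym_pairs k (f : nat -> nat -> R) : (forall i j, f i j = f j i) ->
  \sum_(j < k) \sum_(l < k | l != j) f j l = 2 * \sum_(j < k) \sum_(l < j) f j l.
Proof.
move=> fC; elim: k => [|k IH]; first by rewrite !big_ord0 mulr0.
rewrite big_ord_recr/= [in RHS]big_ord_recr/= mulrDr -IH.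
have -> : \sum_(l < k.+1 | l != ord_max) f k l = \sum_(l < k) f k l.
  rewrite big_mkcond big_ord_recr/= eqxx addr0; apply: eq_bigr => l _.
  by rewrite -val_eqE/= ltn_eqF.
have -> : 2 * \sum_(l < k) f k l = \sum_(l < k) f l k + \sum_(l < k) f k l.
  have -> : \sum_(l < k) f l k = \sum_(l < k) f k l by apply: eq_bigr => l _; exact: fC.
  ring.
rewrite addrA; congr (_ + _).
rewrite -big_split; apply: eq_bigr => j _ /=.
rewrite big_mkcond big_ord_recr/= -big_mkcond/=; congr (_ + _).
by rewrite -val_eqE/= gtn_eqF.
Qed.

Lemma sum_ordR k : 2 * \sum_(j < k) j%:R = k%:R * k.-1%:R :> R.
Proof.
elim: k => [|k IH]; first by rewrite big_ord0 mulr0 mul0r.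
by rewrite big_ord_recr/= mulrDr IH; case: k {IH} => [|k]; rewrite -?natr1 /=; ring.
Qed.

Lemma good_code (w : G -> R) (T : {set G}) k : (forall x, 0 <= w x) ->
  \sum_x w x = 1 -> (0 < k)%N ->
  exists (c : 'I_k -> G) (dec : G -> 'I_k),
    \sum_(x in T) w x - 2 * (k.-1%:R * (#|T|%:R / N%:R)) <=
    \sum_x w x * ((\sum_(j < k) (dec (gadd x (c j)) == j)%:R) / k%:R) ^+ 2.
Proof.
move=> w0 w1 k0; pose a : R := #|T|%:R / N%:R.
(* The probability that an error in T stays in T when shifted by d, a difference of two codewords;
   its average over d is at most |T| / 2^n. *)
pose K d := \sum_(x in T) w x * (gadd x d \in T)%:R.
have Ka : \sum_d K d <= N%:R * a.
  rewrite /a mulrC divfK ?pnatr_eq0 ?expn_eq0//.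
  rewrite /K exchange_big/=.
  apply: (@le_trans _ _ (\sum_(x in T) w x * #|T|%:R)).
    apply: ler_sum => x _; rewrite -mulr_sumr ler_wpM2l//.
    rewrite -sum1_card natr_sum (reindex_inj (@gaddI n x))/= [leRHS]big_mkcond.
    by apply: ler_sum => d _; rewrite gaddK; case: (d \in T).
  rewrite -mulr_suml ler_piMl// -w1 [leRHS](bigID (mem T))/= lerDl.
  exact: sumr_ge0.
have [c0 cP] := greedy_code Ka k.
pose c (j : 'I_k) := c0 j.
(* For y = x + c_j with x in T the index j qualifies, so the default [Ordinal k0] is not reached; an
   error of the decoder exhibits a collision with some l != j. *)
pose dec y : 'I_k := if [pick j | gadd y (c j) \in T] is Some j then j else Ordinal k0.
exists c, dec.
pose g x : R := \sum_(j < k) (dec (gadd x (c j)) == j)%:R.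
have k00 : 0 < k%:R :> R by rewrite ltr0n.
have bad x (j : 'I_k) : x \in T -> 1 - (dec (gadd x (c j)) == j)%:R <=
    \sum_(l < k | l != j) (gadd x (gadd (c j) (c l)) \in T)%:R :> R.
  move=> xT; rewrite /dec; case: pickP => [l lT|/(_ j)]; last first.
    by rewrite gaddC [gadd x _]gaddC gaddK xT.
  have [_|lj] := eqVneq l j; first by rewrite subrr sumr_ge0.
  by rewrite subr0 (bigD1 l)//= gaddA lT lerDl sumr_ge0.
have sumbad : \sum_(x in T) w x * (k%:R - g x) <= k%:R * (k.-1%:R * a).
  apply: (@le_trans _ _ (\sum_(j < k) \sum_(l < k | l != j) K (gadd (c j) (c l)))).
    rewrite /K; under [leRHS]eq_bigr do rewrite exchange_big/=.
    rewrite exchange_big/=; apply: ler_sum => x xT.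
    under [leRHS]eq_bigr do rewrite -mulr_sumr.
    rewrite -mulr_sumr ler_wpM2l// /g -[X in X%:R]card_ord -sumr_const -sumrB.
    by apply: ler_sum => j _; exact: bad.
  rewrite (@sum_sym_pairs k (fun j l => K (gadd (c0 j) (c0 l)))); last first.
    by move=> i j; rewrite gaddC.
  apply: (@le_trans _ _ (2 * \sum_(j < k) j%:R * a)); first by rewrite ler_wpM2l.
  rewrite -mulr_suml mulrA mulrA ler_wpM2r//; first by rewrite divr_ge0.
  by rewrite sum_ordR.
(* (g/k)^2 exceeds 1 - 2 (1 - g/k) by the square of 1 - g/k; this linearises the fidelity in the
   number of decoding failures. *)
have termwise x : w x - 2 / k%:R * (w x * (k%:R - g x)) <= w x * (g x / k%:R) ^+ 2.
  have h : 0 <= (1 - g x / k%:R) ^+ 2 by exact: sqr_ge0.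
  have := mulr_ge0 (w0 x) h; rewrite -subr_ge0 => h2; rewrite -subr_ge0.
  have -> : w x * (g x / k%:R) ^+ 2 - (w x - 2 / k%:R * (w x * (k%:R - g x))) =
    w x * (1 - g x / k%:R) ^+ 2 by field; rewrite gt_eqF.
  by rewrite subr0 in h2.
rewrite [leRHS](bigID (mem T))/=.
apply: (@le_trans _ _ (\sum_(x in T) w x * (g x / k%:R) ^+ 2)); last first.
  by rewrite lerDl sumr_ge0// => x _; rewrite mulr_ge0// sqr_ge0.
apply: (@le_trans _ _ (\sum_(x in T) (w x - 2 / k%:R * (w x * (k%:R - g x)))));
  last by apply: ler_sum => x _.
rewrite sumrB lerD2l lerN2 -mulr_sumr -mulrA ler_wpM2l// mulrC.
by rewrite ler_pdivrMr// mulrC.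
Qed.

End Coding.

(** * Asymptotics *)

Section WeightDistribution.
Variable R : realType.

Definition ffun_cons n (b : bool) (y : {ffun 'I_n -> bool}) : {ffun 'I_n.+1 -> bool} :=
  [ffun i => oapp y b (unlift ord0 i)].

Lemma ffun_cons0 n b (y : {ffun 'I_n -> bool}) : ffun_cons b y ord0 = b.
Proof. by rewrite ffunE unlift_none. Qed.

Lemma ffun_consS n b (y : {ffun 'I_n -> bool}) i : ffun_cons b y (lift ord0 i) = y i.
Proof. by rewrite ffunE liftK. Qed.

Lemma sum_ffun_cons n (F : {ffun 'I_n.+1 -> bool} -> R) :
  \sum_x F x = \sum_(y : {ffun 'I_n -> bool}) (F (ffun_cons true y) + F (ffun_cons false y)).
Proof.
pose h (by_ : bool * {ffun 'I_n -> bool}) := ffun_cons by_.1 by_.2.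
rewrite (reindex h)/=; last first.
  exists (fun x => (x ord0, [ffun j => x (lift ord0 j)])) => [[b y] _|x _].
    rewrite /h /= ffun_cons0; congr (_, _).
    by apply/ffunP => j; rewrite ffunE ffun_consS.
  apply/ffunP => i; rewrite /h /=.
  by case: (unliftP ord0 i) => [j|] ->; rewrite ?ffun_consS ?ffun_cons0 ?ffunE.
rewrite -(pair_bigA _ (fun b y => F (ffun_cons b y)))/= exchange_big.
by apply: eq_bigr => y _; rewrite big_bool.
Qed.

Definition count_bit n (b : bool) (x : {ffun 'I_n -> bool}) : nat :=
  \sum_m (x m == b).

Lemma count_bit_cons n b c (y : {ffun 'I_n -> bool}) :
  count_bit b (ffun_cons c y) = ((c == b) + count_bit b y)%N.
Proof.
rewrite /count_bit big_ord_recl ffun_cons0; congr (_ + _)%N.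
by apply: eq_bigr => m _; rewrite ffun_consS.
Qed.

Lemma weight_cons n (p : R) c (y : {ffun 'I_n -> bool}) :
  weight p (ffun_cons c y) = (if c then 1 - p else p) * weight p y.
Proof.
rewrite /weight big_ord_recl ffun_cons0; congr (_ * _).
by apply: eq_bigr => m _; rewrite ffun_consS.
Qed.

(** Conditioning on the first bit reproduces the recursion of [binE], with the probability of b as
    success probability. *)
Lemma sum_weight_count n (p : R) b (f : nat -> R) :
  \sum_(x : {ffun 'I_n -> bool}) weight p x * f (count_bit b x) =
  binE (if b then 1 - p else p) n f.
Proof.
elim: n f => [|n IH] f.
  rewrite (big_pred1 [ffun=> false]); last first.
    by move=> x; apply/esym/eqP/ffunP => -[].
  by rewrite /weight /count_bit !big_ord0 mul1r.
have E c : \sum_(y : {ffun 'I_n -> bool})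
      weight p (ffun_cons c y) * f (count_bit b (ffun_cons c y)) =
    (if c then 1 - p else p) *
      binE (if b then 1 - p else p) n (fun k => f ((c == b) + k)%N).
  rewrite -IH mulr_sumr; apply: eq_bigr => y _.
  by rewrite weight_cons count_bit_cons mulrA.
rewrite sum_ffun_cons big_split !E /=; case: (b) => //=.
  by rewrite subKr.
by rewrite addrC.
Qed.

Lemma sum_weight n (p : R) : \sum_(x : {ffun 'I_n -> bool}) weight p x = 1.
Proof.
have := sum_weight_count n p true (fun=> 1).
by rewrite binE_cst => <-; apply: eq_bigr => x _; rewrite mulr1.
Qed.

Lemma weightE n (p : R) b (x : {ffun 'I_n -> bool}) : 0 < p -> p < 1 ->
  let q := if b then 1 - p else p in
  weight p x = (1 - q) ^+ n * (q / (1 - q)) ^+ count_bit b x.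
Proof.
move=> p0 p1 q.
have q1 : 1 - q != 0.
  by rewrite gt_eqF// /q; case: (b); rewrite ?subKr// subr_gt0.
have -> : (1 - q) ^+ n = \prod_(m < n) (1 - q) by rewrite prodr_const card_ord.
rewrite /count_bit -prodrXr -big_split; apply: eq_bigr => m _ /=.
by move: q1; rewrite /q; case: (b); case: (x m);
  rewrite ?expr1 ?expr0 ?mulr1 ?subKr => q1//; rewrite mulrC divfK.
Qed.

End WeightDistribution.

(** * Both bounds for the optimal fidelity *)

Section FidelityBounds.
Variables (R : realType) (p : R) (Omega : operation_class) (n k : nat).
Hypotheses (p0 : 0 < p) (p1 : p < 1) (k0 : (0 < k)%N).
Local Notation F := (distillation_fidelity Omega (bipower (rho_bell p) n.+1) k).

Lemma distillation_fidelity_le (t : R) : 0 <= t ->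
  F <= \sum_(x : {ffun 'I_n.+1 -> bool} | t < weight p x) weight p x +
    t * (2 ^ n.+1)%:R / k%:R.
Proof.
move=> t0; rewrite /distillation_fidelity; set S := [set f | _].
have ub : ubound S (\sum_(x : {ffun 'I_n.+1 -> bool} | t < weight p x) weight p x +
    t * (2 ^ n.+1)%:R / k%:R).
  by move=> f [Pi [PiO ->]]; exact: (fidelity_le p0 p1 t0 k0 PiO).
(* The [sup] of the empty set is 0, which the nonnegative bound also covers. *)
have [->|/set0P S0] := eqVneq S set0; last exact: (ge_sup S0 ub).
rewrite sup0 addr_ge0//; last by rewrite divr_ge0 ?mulr_ge0.
by apply: sumr_ge0 => x _; exact: weight_ge0.
Qed.

Lemma distillation_fidelity_ge (T : {set {ffun 'I_n.+1 -> bool}}) :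
  \sum_(x in T) weight p x - 2 * (k.-1%:R * (#|T|%:R / (2 ^ n.+1)%:R)) <= F.
Proof.
have [c [dec /le_trans]] := good_code T (fun x => weight_ge0 x p0 p1) (sum_weight _ _) k0.
apply; have [Pi [PiO <-]] := protocol_fidelity Omega p c dec k0.
apply: ub_le_sup; last by exists Pi.
(* The converse at t = 0 supplies the upper bound that makes [sup] a genuine supremum. *)
exists (\sum_(x : {ffun 'I_n.+1 -> bool} | 0 < weight p x) weight p x +
    0 * (2 ^ n.+1)%:R / k%:R) => f [Pi' [PiO' ->]].
exact: (fidelity_le p0 p1 (lexx 0) k0 PiO').
Qed.

End FidelityBounds.

Section Logarithm.
Variable R : realType.

Lemma ln2_gt0 : 0 < ln 2 :> R. Proof. by rewrite ln_gt0// ltr1n. Qed.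

Lemma log2M (x y : R) : 0 < x -> 0 < y -> log2 (x * y) = log2 x + log2 y.
Proof. by move=> x0 y0; rewrite /log2 lnM ?posrE// mulrDl. Qed.

Lemma log2V (x : R) : 0 < x -> log2 x^-1 = - log2 x.
Proof. by move=> x0; rewrite /log2 lnV ?posrE// mulNr. Qed.

Lemma log2X (x : R) n : 0 < x -> log2 (x ^+ n) = n%:R * log2 x.
Proof. by move=> x0; rewrite /log2 lnXn// -[ln x *+ n]mulr_natl mulrA. Qed.

Lemma log2_le (x y : R) : 0 < x -> x <= y -> log2 x <= log2 y.
Proof.
move=> x0 xy; rewrite /log2 ler_wpM2r ?invr_ge0 ?(ltW ln2_gt0)//.
by rewrite ler_ln ?posrE// (lt_le_trans x0).
Qed.

Lemma log2_2 : log2 2 = 1 :> R.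
Proof. by rewrite /log2 mulfV// gt_eqF// ln2_gt0. Qed.

Lemma log2_ge0 (x : R) : 1 <= x -> 0 <= log2 x.
Proof. by move=> x1; apply: divr_ge0; [exact: ln_ge0|exact/ltW/ln2_gt0]. Qed.

Lemma log2_nat_bounded (M : R) : exists B : nat, forall k : nat, (0 < k)%N ->
  log2 (k%:R : R) <= M -> (k <= B)%N.
Proof.
exists (Num.truncn (expR (M * ln 2))) => k k0.
rewrite /log2 ler_pdivrMr ?ln2_gt0// => h.
rewrite truncn_ge_nat ?expR_ge0// -[leLHS]lnK ?posrE ?ltr0n//.
by rewrite ler_expR.
Qed.

End Logarithm.

Lemma max_natP (S : set nat) (k0 B : nat) : S k0 ->
  (forall k, S k -> (k <= B)%N) -> S (max_nat S) /\ forall k, S k -> (k <= max_nat S)%N.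
Proof.
move=> Sk0 SB.
have ex : exists k, `[< S k >] by exists k0; exact/asboolP.
have ub k : `[< S k >] -> (k <= B)%N by move=> /asboolP; exact: SB.
have [m /asboolP Sm mP] := ex_maxnP ex ub.
rewrite /max_nat; case: xgetP => [k _ [Sk kP] //|/(_ m)].
by case; split=> // j Sj; apply: mP; exact/asboolP.
Qed.

Section LikelySymbol.
Variables (R : realType) (p : R).
Hypotheses (p0 : 0 < p) (p1 : p < 1).

(* Weights are monotone in the number of occurrences of the likelier bit, so that
   p < 1/2 and p > 1/2 need no separate treatment. *)
Definition likely_bit : bool := p < 2^-1.
Definition likely_prob : R := if likely_bit then 1 - p else p.
Definition likely_odds : R := likely_prob / (1 - likely_prob).

Lemma likely_prob_gt0 : 0 < likely_prob.
Proof. by rewrite /likely_prob; case: ifP => _ //; rewrite subr_gt0. Qed.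

Lemma likely_prob_lt1 : likely_prob < 1.
Proof. by rewrite /likely_prob; case: ifP => _ //; rewrite gtrBl. Qed.

Lemma likely_odds_ge1 : 1 <= likely_odds.
Proof.
rewrite /likely_odds ler_pdivlMr ?subr_gt0 ?likely_prob_lt1// mul1r.
by rewrite /likely_prob /likely_bit; case: ltP => pb; lra.
Qed.

Lemma likely_odds_gt0 : 0 < likely_odds.
Proof. exact: lt_le_trans likely_odds_ge1. Qed.

Lemma log2_likely_odds : log2 likely_odds = log2 likely_prob - log2 (1 - likely_prob).
Proof.
have q1 : 0 < 1 - likely_prob by rewrite subr_gt0 likely_prob_lt1.
by rewrite log2M ?invr_gt0 ?likely_prob_gt0// log2V.
Qed.

Lemma binary_entropy_likely : 1 - binary_entropy p =
  1 + log2 (1 - likely_prob) + likely_prob * log2 likely_odds.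
Proof.
rewrite log2_likely_odds /binary_entropy /likely_prob; case: ifP => _; last by ring.
by rewrite subKr; ring.
Qed.

(** The square root of the squared logarithm is its absolute value, which is the logarithm of the
    odds that are at least 1. *)
Lemma deviation_likely (c : R) : 0 <= c ->
  Num.sqrt (c * (p * (1 - p) * log2 ((1 - p) / p) ^+ 2)) =
  Num.sqrt (c * (likely_prob * (1 - likely_prob))) * log2 likely_odds.
Proof.
move=> c0; have p1' : 0 < 1 - p by rewrite subr_gt0.
have L0 : 0 <= log2 likely_odds by apply/log2_ge0/likely_odds_ge1.
rewrite mulrA sqrtrM; last by rewrite mulr_ge0// mulr_ge0// ltW.
rewrite sqrtr_sqr -[in RHS](ger0_norm L0) log2_likely_odds /likely_prob.
rewrite log2M ?invr_gt0// log2V//; case: ifP => _; rewrite ?subKr.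
  by rewrite [p * _]mulrC.
by rewrite distrC.
Qed.

End LikelySymbol.

(** * Bounds for a fixed number of copies *)

Section OneShot.
Variables (R : realType) (p eps : R) (Omega : operation_class).
Hypotheses (p0 : 0 < p) (p1 : p < 1) (eps0 : 0 < eps) (eps1 : eps < 1).
Local Notation b := (likely_bit p).
Local Notation q := (likely_prob p).
Local Notation r := (likely_odds p).

Let q1' : 0 < 1 - q. Proof. by rewrite subr_gt0 likely_prob_lt1. Qed.

Let r1 : 1 <= r. Proof. exact: likely_odds_ge1. Qed.

Let r0 : 0 < r. Proof. exact: likely_odds_gt0. Qed.

Variable n : nat.
Local Notation nu := n.+1.
Local Notation G := {ffun 'I_nu -> bool}.
Local Notation u := (Num.sqrt (nu.+1%:R : R)).
Local Notation rhon := (bipower (rho_bell p) nu).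

(** The weight of an error with m occurrences of the likelier bit. *)
Definition threshold (m : nat) : R := (1 - q) ^+ nu * r ^+ m.

Lemma threshold_gt0 m : 0 < threshold m.
Proof. by rewrite mulr_gt0// exprn_gt0. Qed.

Lemma log2_threshold m : log2 (threshold m) = nu%:R * log2 (1 - q) + m%:R * log2 r.
Proof. by rewrite log2M ?exprn_gt0// !log2X. Qed.

Lemma threshold_weight m (x : G) : (m <= count_bit b x)%N -> threshold m <= weight p x.
Proof.
move=> mx; rewrite (weightE b x p0 p1) -/q -/r ler_wpM2l ?exprn_ge0 ?(ltW q1')//.
exact: ler_weXn2l.
Qed.

(** Only weak monotonicity in the count is available: at p = 1/2 the odds are 1 and all weights
    coincide. *)
Lemma weight_threshold m (x : G) : threshold m < weight p x -> (m <= count_bit b x)%N.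
Proof.
rewrite (weightE b x p0 p1) -/q -/r ltr_pM2l ?exprn_gt0// => h.
rewrite leqNgt; apply/negP => xm; move: h; rewrite ltNge.
by rewrite ler_weXn2l// ltnW.
Qed.

Lemma sum_weight_ge m :
  \sum_(x : G) weight p x * (m <= count_bit b x)%N%:R =
  1 - binE q nu (fun k => (k < m)%N%:R).
Proof.
rewrite -[X in _ = X - _](sum_weight nu p) -sum_weight_count -sumrB; apply: eq_bigr => x _.
rewrite ltnNge -[X in _ = X - _]mulr1 -mulrBr; congr (_ * _).
by case: leqP => _; [exact: (esym (subr0 (1 : R)))|exact: (esym (subrr (1 : R)))].
Qed.

Let S := [set k | (1 <= k)%N /\ 1 - eps <= distillation_fidelity Omega rhon k].

Lemma u_gt0 : 0 < u. Proof. by rewrite sqrtr_gt0. Qed.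

Lemma distillable_lower m : binE q nu (fun k => (k < m)%N%:R) <= eps - 2 / u ->
  exists2 k, S k & nu%:R + log2 (threshold m) - log2 u <= log2 (k%:R : R).
Proof.
move=> hm; pose t := threshold m; have t0 : 0 < t by exact: threshold_gt0.
have u0 := u_gt0; have N0 : 0 < (2 ^ nu)%:R :> R by rewrite ltr0n expn_gt0.
have tN0 : 0 < t * (2 ^ nu)%:R / u by apply: divr_gt0 => //; exact: mulr_gt0.
have /truncn_itv/andP[k1 k2] := ltW tN0.
(* Then k > t 2^nu / u gives the rate, while k - 1 <= t 2^nu / u and |T| <= 1/t keep the collision
   term below 2/u, the slack in [hm]. *)
set k := (Num.truncn _).+1 in k2 *; exists k; last first.
  apply: (@le_trans _ _ (log2 (t * (2 ^ nu)%:R / u))); last by rewrite log2_le// ltW.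
  have tN : 0 < t * (2 ^ nu)%:R by exact: mulr_gt0.
  rewrite (log2M tN) ?invr_gt0// (log2M t0 N0) (log2V u0) natrX log2X// log2_2 mulr1.
  by rewrite [_ + nu%:R]addrC.
split=> //; pose T : {set G} := finset (fun x => t <= weight p x).
apply: (le_trans _ (distillation_fidelity_ge Omega p0 p1 (ltn0Sn _) T)) => /=.
have PT : 1 - eps + 2 / u <= \sum_(x in T) weight p x.
  apply: (@le_trans _ _ (\sum_(x : G) weight p x * (m <= count_bit b x)%N%:R)).
    by rewrite sum_weight_ge; lra.
  rewrite [leRHS]big_mkcond; apply: ler_sum => x _; rewrite inE.
  case: (leqP m) => [/threshold_weight ->|_]; first by rewrite mulr1.
  by rewrite mulr0; case: ifP => // _; exact: weight_ge0.
have cT : #|T|%:R <= t^-1.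
  rewrite -[leRHS]mul1r ler_pdivlMr// mulr_natl -[leRHS](sum_weight nu p) -sumr_const.
  rewrite [leRHS](bigID (mem T))/= ler_wpDr//.
    by apply: sumr_ge0 => x _; exact: weight_ge0.
  by apply: ler_sum => x; rewrite inE.
have : (Num.truncn (t * (2 ^ nu)%:R / u))%:R * (#|T|%:R / (2 ^ nu)%:R) <= u^-1.
  apply: (@le_trans _ _ ((t * (2 ^ nu)%:R / u) * (t^-1 / (2 ^ nu)%:R))).
    by rewrite ler_pM// ?divr_ge0// ler_wpM2r// invr_ge0 ltW.
  have -> : t * (2 ^ nu)%:R / u * (t^-1 / (2 ^ nu)%:R) = u^-1.
    by field; rewrite !gt_eqF.
  exact: lexx.
by lra.
Qed.

(** The probability of weights above the threshold falls short of 1 - eps by 2/u, so the term t 2^nu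
    / k must supply at least 1/u, which bounds k. *)
Lemma distillable_upper m k : eps + 2 / u <= binE q nu (fun k => (k < m)%N%:R) ->
  S k -> log2 (k%:R : R) <= nu%:R + log2 (threshold m) + log2 u.
Proof.
move=> hm [k0 Sk]; pose t := threshold m; have t0 : 0 < t by exact: threshold_gt0.
have u0 := u_gt0; have N0 : 0 < (2 ^ nu)%:R :> R by rewrite ltr0n expn_gt0.
have k00 : 0 < k%:R :> R by rewrite ltr0n.
have {}Sk := le_trans Sk (distillation_fidelity_le Omega n p0 p1 k0 (ltW t0)).
have PT : \sum_(x : G | t < weight p x) weight p x <= 1 - eps - 2 / u.
  apply: (@le_trans _ _ (\sum_(x : G) weight p x * (m <= count_bit b x)%N%:R)).
    rewrite big_mkcond; apply: ler_sum => x _.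
    case: ifPn => [/weight_threshold ->|_]; first by rewrite mulr1.
    by rewrite mulr_ge0// weight_ge0.
  by rewrite sum_weight_ge; lra.
have kt : u^-1 <= t * (2 ^ nu)%:R / k%:R.
  have : 0 < u^-1 by rewrite invr_gt0.
  by lra.
have : k%:R <= 2 ^+ nu * t * u.
  move: kt; rewrite ler_pdivlMr// mulrC ler_pdivrMr// natrX.
  by rewrite [t * _]mulrC.
move=> /(log2_le k00); rewrite !log2M ?mulr_gt0 ?exprn_gt0//.
by rewrite log2X// log2_2 mulr1.
Qed.

Lemma distillable_entanglement_bounds m1 m2 :
  binE q nu (fun k => (k < m1)%N%:R) <= eps - 2 / u ->
  eps + 2 / u <= binE q nu (fun k => (k < m2)%N%:R) ->
  nu%:R + log2 (threshold m1) - log2 u <= distillable_entanglement Omega eps rhon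
    <= nu%:R + log2 (threshold m2) + log2 u.
Proof.
move=> h1 h2; have [k Sk kE] := distillable_lower h1.
have [B BP] := log2_nat_bounded (nu%:R + log2 (threshold m2) + log2 u).
have [|SM MP] := @max_natP S k B Sk.
  by move=> j Sj; apply: BP; [case: Sj|exact: distillable_upper].
apply/andP; split; last exact: distillable_upper.
apply: le_trans kE _; apply: log2_le; last by rewrite ler_nat MP.
by rewrite ltr0n; case: Sk.
Qed.

End OneShot.

Lemma distillable_entanglement_expansion (R : realType) (p eps : R) (Omega : operation_class) :
  0 < p -> p < 1 -> 0 < eps -> eps < 1 ->
  exists (K : R) (M : nat), forall n : nat, (M <= n)%N ->
    `|distillable_entanglement Omega eps (bipower (rho_bell p) n) -
      (n%:R * (1 - binary_entropy p)
       + Num.sqrt (n%:R * (p * (1 - p) * log2 ((1 - p) / p) ^+ 2))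
         * normal_cdf_inv eps)| <= K * log2 n%:R.
Proof.
move=> p0 p1 e0 e1; pose q := likely_prob p; pose L := log2 (likely_odds p).
have L0 : 0 <= L by apply/log2_ge0/likely_odds_ge1.
have B2 : 0 <= 2 :> R by [].
have [A [M AM]] := binomial_quantile (likely_prob_gt0 p0 p1) (likely_prob_lt1 p0 p1) e0 e1 B2.
(* The logarithm of the threshold has slope L in m, so the quantile error A costs |A| L; the 1 pays
   for log2 u. From two copies on, log2 n is at least 1 and sqrt(n + 1) <= n. *)
exists (`|A| * L + 1), (maxn M 2) => n; rewrite geq_max => /andP[Mn n2].
case: n Mn n2 => // n Mn n2.
have [[m1 [m1E h1]] [m2 [m2E h2]]] := AM _ Mn.
have := distillable_entanglement_bounds Omega p0 p1 h1 h2.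
rewrite !log2_threshold// -/q -/L => /andP[lo up].
rewrite deviation_likely ?ler0n// binary_entropy_likely// -/q -/L.
move: m1E m2E; rewrite -/q; set X := Num.sqrt (n.+1%:R * _); set x0 := normal_cdf_inv eps.
move=> m1E m2E.
have hA := ler_norm A.
have m1L := ler_wpM2r L0 m1E; have m2L := ler_wpM2r L0 m2E.
have AL : A * L <= `|A| * L by rewrite ler_wpM2r.
have n1 : 1 <= log2 n.+1%:R :> R.
  by rewrite -[leLHS](log2_2 R); apply: log2_le => //; rewrite ler_nat.
have un : log2 (Num.sqrt n.+2%:R) <= log2 n.+1%:R :> R.
  apply: log2_le; first by rewrite sqrtr_gt0.
  have n2S : n.+2%:R <= n.+1%:R ^+ 2 :> R by rewrite -natrX ler_nat -mulnn; clear -n2; nia.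
  by apply: (le_trans (ler_wsqrtr n2S)); rewrite sqrtr_sqr ger0_norm.
have AL1 : `|A| * L <= `|A| * L * log2 n.+1%:R.
  by rewrite ler_peMr// mulr_ge0.
rewrite ler_norml; apply/andP; split.
  by move: lo m1L un AL AL1; clear; lra.
by move: up m2L un AL AL1; clear; lra.
Qed.

Theorem proposition9 (R : realType) (p eps : R) (Omega : operation_class)
  (hp0 : 0 < p) (hp1 : p < 1) (heps0 : 0 < eps) (heps1 : eps < 1) :
  (fun n : nat => distillable_entanglement Omega eps (bipower (rho_bell p) n))
  = (fun n : nat => n%:R * (1 - binary_entropy p)
       + Num.sqrt (n%:R * (p * (1 - p) * log2 ((1 - p) / p) ^+ 2))
         * normal_cdf_inv eps)
  +O_\oo (fun n : nat => log2 (n%:R : R)).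
Proof.
have [K [M KM]] := distillable_entanglement_expansion Omega hp0 hp1 heps0 heps1.
apply/eqaddOP; near=> C; near=> n.
have Mn : (M <= n)%N by near: n; exact: nbhs_infty_ge.
apply: (le_trans (KM n Mn)); apply: (@le_trans _ _ (`|K| * `|log2 (n%:R : R)|)).
  by rewrite -normrM ler_norm.
by rewrite ler_wpM2r//; near: C; apply: nbhs_pinfty_ge; exact: num_real.
Unshelve. all: by end_near.
Qed.
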